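(* Let $\mu$ be a sigma-finite Borel measure on $\mathbb{R}$ without atoms, let $U\subset\mathbb{R}$ be a Borel subset with $\mu(\mathbb{R}\setminus U)=0$, and let $H$ be a reproducing kernel subspace in $L^2(\mathbb{R},\mu)$ (of functions on $U$) such that for any $k\in U$ one has the implication $$f\in H\ \Longrightarrow\ \frac{f(x)-f(k)}{x-k}\in H.$$ Let $\mathcal{N}=\{z\in\mathbb{C}\setminus\partial U:\ (\cdot-z)^{-1}\in H\}$. Then $\mathcal{N}$ is a subset of $\mathbb{C}\setminus\mathrm{clos}\,U$, $\mathcal{N}$ is discrete in $\mathbb{C}\setminus\partial U$, and any function from $H$ extends to a meromorphic function on $\mathbb{C}\setminus\partial U$ with all poles lying in $\mathcal{N}$.
   Context: Functions are complex-valued. A linear set $H$ of Borel functions $f$ on $U$ (actual functions, not equivalence classes) satisfying $\int|f|^2\,d\mu<\infty$ is called a reproducing kernel subspace in $L^2(\mathbb{R},\mu)$ if it is closed in the $L^2(\mathbb{R},\mu)$ norm and, for every $k\in U$, the functional $f\mapsto f(k)$ on $H$ is bounded in the $L^2(\mathbb{R},\mu)$ norm. An expression of the form $g/(x-p)\in H$ means that there is a (unique) function $h\in H$ such that $h(x)(x-p)=g(x)$ for all $x\in U$, and $g/(x-p)$ then denotes this $h$; in particular $\frac{f(x)-f(k)}{x-k}\in H$ and $(\cdot-z)^{-1}\in H$ are understood in this sense. $\mathrm{clos}\,U$ is the closure of $U$ and $\partial U$ is the boundary of $U$ as a subset of $\mathbb{R}$. A set is discrete in an open set $G$ if it has no accumulation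 points in $G$. An extension of $f\in H$ to $\mathbb{C}\setminus\partial U$ is a function agreeing with $f$ on $U\setminus\partial U$.
   Formalization: The set U is assumed nonempty; for U empty (so μ = 0 and H contains only the empty function) the condition (·−z)^{-1} ∈ H holds vacuously for every z, so 𝒩 = ℂ is not discrete and the claim fails. *)

(* Defs.v *)
From HB Require Import structures.
From mathcomp Require Import all_boot all_order all_algebra.
From mathcomp Require Import complex.
From mathcomp Require Import all_classical all_reals all_analysis.

Set Implicit Arguments.
Unset Strict Implicit.
Unset Printing Implicit Defensive.

Import Order.TTheory GRing.Theory Num.Theory numFieldNormedType.Exports.

Local Open Scope classical_set_scope.
Local Open Scope ring_scope.
Local Open Scope complex_scope.

(* The topology and the normed R[i]-module structure of the complex plane live
   on the regular algebra R[i]^o, which is convertible to R[i]; in particular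
   [derivable f z 1] for f : Cplane R -> Cplane R is complex
   differentiability. *)
Notation Cplane R := ((complex (Real.sort R))^o).

(* A function on U is represented by its extension by 0 to the whole line,
   so that equality of representatives is equality of functions on U. *)
Definition fun_on (R : realType) (U : set R) (f : R -> R[i]) : Prop :=
  forall x, ~ U x -> f x = 0.

Definition borel_fun (R : realType) (U : set R) (f : R -> R[i]) : Prop :=
  measurable_fun U (f : R -> g_sigma_algebraType (@open (Cplane R))).

Definition square_integrable (R : realType) (mu : {measure set R -> \bar R})
    (U : set R) : set (R -> R[i]) :=
  [set f | [/\ fun_on U f, borel_fun U f &
    (\int[mu]_(x in U) ((Normc.normc (f x)) ^+ 2)%:E < +oo)%E]].

Definition L2norm (R : realType) (mu : {measure set R -> \bar R})
    (f : R -> R[i]) : \bar R :=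
  Lnorm mu 2%:E (fun x => (Normc.normc (f x))%:E).

(* The elements of H are functions and not classes, hence closedness only asks
   that an L2-limit of elements of H agree a.e. with an element of H. *)
Record reproducing_kernel_subspace (R : realType)
    (mu : {measure set R -> \bar R}) (U : set R) (H : set (R -> R[i])) : Prop :=
  ReproducingKernelSubspace {
    rks_sub : H `<=` square_integrable mu U ;
    rks_zero : H (fun=> 0) ;
    rks_lin : forall (a : R[i]) (f g : R -> R[i]),
      H f -> H g -> H (fun x => a * f x + g x) ;
    rks_closed : forall (u : nat -> R -> R[i]) (f : R -> R[i]),
      (forall n, H (u n)) -> square_integrable mu U f ->
      L2norm mu (fun x => u n x - f x) @[n --> \oo] --> 0%E ->
      exists2 g, H g & {ae mu, forall x, U x -> g x = f x} ;
    rks_eval : forall k, U k -> exists C : R, forall f, H f ->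
      ((Normc.normc (f k))%:E <= C%:E * L2norm mu f)%E
  }.

(* g / (x - p) \in H. When mu has no atoms and H is a reproducing kernel
   subspace, h is unique: two candidates can only differ at p, so that the L2
   norm of their difference is 0. *)
Definition quotient_in (R : realType) (U : set R) (H : set (R -> R[i]))
    (g : R -> R[i]) (p : R[i]) : Prop :=
  exists2 h, H h & forall x, U x -> h x * (x%:C - p) = g x.

Definition boundary (R : realType) (U : set R) : set R :=
  closure U `\` interior U.

Definition embed_line (R : realType) (A : set R) : set (Cplane R) :=
  [set x%:C | x in A].

Definition off_boundary (R : realType) (U : set R) : set (Cplane R) :=
  ~` embed_line (boundary U).

Definition cauchy_kernel_set (R : realType) (U : set R) (H : set (R -> R[i])) :
    set (Cplane R) :=
  [set z | off_boundary U z /\ quotient_in U H (fun=> 1) z].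

Definition discrete_in (R : realType) (G A : set (Cplane R)) : Prop :=
  forall z, G z -> ~ limit_point A z.

(* F is unconstrained at p itself. *)
Definition has_pole (R : realType) (F : Cplane R -> Cplane R) (p : Cplane R) :
    Prop :=
  exists (n : nat) (h : Cplane R -> Cplane R),
    [/\ (0 < n)%N, h p != 0, (\forall w \near p, derivable h w 1) &
      \forall w \near p, w != p -> F w = h w / (w - p) ^+ n].

(* F is meromorphic on the open set G, with P as its set of poles; the values
   of F outside G `\` P are irrelevant. *)
Definition meromorphic_on (R : realType) (G P : set (Cplane R))
    (F : Cplane R -> Cplane R) : Prop :=
  [/\ P `<=` G, discrete_in G P,
    (forall z, G z -> ~ P z -> derivable F z 1) &
    forall p, P p -> has_pole F p].

(* Main.v *)
(* For z off the closure of U, the value at z of the extension of f is the number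
   c such that (f - c) / (x - z) lies in H.  For k in U the operator
   T_k f = (f - f(k)) / (x - k) is bounded (uniform boundedness, applied to its
   truncations away from k), and a Neumann series for 1 - (z - k) T_k produces c
   for all z near k; difference quotients of c are again of this form, which
   gives complex differentiability.
   Let phi = 1 / (x - z0) with z0 off the closure of U.  If all powers of phi lie
   in H, then 1 / (x - z) is in H for all z near z0.  Otherwise take the least n
   with phi^(n+1) not in H and replace c by c phi^n: the positive distance from
   phi^(n+1) to H bounds c uniformly near z0, so a single z near z0 where the
   problem is solvable makes it solvable on a whole disc around z0, and dividing
   by (z - z0)^n recovers the original problem, with a pole of order at most n.
   Hence solvability on punctured neighbourhoods is a locally constant property
   off the closure of U; it holds near every k in U, so on both half-planes by
   connectedness, and then at the real points outside the closure of U. *)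
Require Import Defs.
From HB Require Import structures.
From mathcomp Require Import all_boot all_order all_algebra.
From mathcomp Require Import complex.
From mathcomp Require Import all_classical all_reals all_analysis.
From mathcomp Require Import measurable_realfun.
From mathcomp Require Import ring lra.

Import Order.TTheory GRing.Theory Num.Theory numFieldNormedType.Exports.

Local Open Scope classical_set_scope.
Local Open Scope ring_scope.
Local Open Scope complex_scope.

Set Implicit Arguments.
Unset Strict Implicit.
Unset Printing Implicit Defensive.

(** Elements of [H] are functions, so null sets matter: bounded evaluations make an element of norm
    zero vanish identically, and a function outside [H] can still be at L2 distance zero from it.
    The distance that bounds c therefore includes the evaluation at one point k of [U]. The argument
    needs phi in L2, which is extracted from some f in [H] with f(k) nonzero; the case [H] = 0 is
    treated apart. The problem at z is kept as a relation [res] between f, c and h, and [bres]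
    bounds all its solutions; at f = 0 this is uniqueness. Since 1 / (x - z) in [H] solves the
    problem with f = 0 and c = -1, a bound at z excludes the kernel there, which separates the two
    alternatives near z0. The bound near z0 does not depend on z, so the Neumann radius does not
    shrink and one disc serves every starting point in it. *)

Local Notation normc := (@Normc.normc _).
Local Notation Re := (@complex.Re _).
Local Notation Im := (@complex.Im _).

(** * Complex modulus and Borel functions *)

Section Normc.
Context {R : realType}.
Implicit Types x y z : R[i].

Lemma norm_normc x : `|x| = (normc x)%:C.
Proof. by rewrite normc_def; case: x. Qed.

Lemma normc_ge0 x : 0 <= normc x.
Proof. by case: x => a b; exact: sqrtr_ge0. Qed.

Lemma normcD x y : normc (x + y) <= normc x + normc y.
Proof. by rewrite -lecR rmorphD/= -!norm_normc ler_normD. Qed.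

Lemma normcN x : normc (- x) = normc x.
Proof. by have := normrN x; rewrite !norm_normc => /complexI. Qed.

Lemma normcB x y : normc (x - y) = normc (y - x).
Proof. by rewrite -normcN opprB. Qed.

Lemma normcX x n : normc (x ^+ n) = normc x ^+ n.
Proof.
elim: n => [|n ih]; first by rewrite !expr0 Normc.normc1.
by rewrite !exprS Normc.normcM ih.
Qed.

Lemma normcR (a : R) : normc a%:C = `|a|.
Proof. by rewrite /normc/= expr0n/= addr0 sqrtr_sqr. Qed.

Lemma normc_gt0 x : (0 < normc x) = (x != 0).
Proof. by rewrite -ltcR -norm_normc normr_gt0. Qed.

Lemma Re_le_normc x : `|Re x| <= normc x.
Proof. by have := normc_ge_Re x; rewrite norm_normc lecR. Qed.

Lemma Im_le_normc x : `|Im x| <= normc x.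
Proof.
case: x => a b /=; rewrite -[`|b|]ger0_norm// -sqrtr_sqr ler_wsqrtr//.
by rewrite real_normK ?num_real// lerDr sqr_ge0.
Qed.

Lemma normc_le_ReIm x : normc x <= `|Re x| + `|Im x|.
Proof.
case: x => a b /=; rewrite -[leRHS]ger0_norm ?addr_ge0// -sqrtr_sqr ler_wsqrtr//.
rewrite sqrrD !real_normK ?num_real// [leRHS]addrAC lerDl.
by rewrite mulrn_wge0 ?mulr_ge0.
Qed.

Lemma gt0_ReE x : 0 < x -> x = (Re x)%:C.
Proof. by case: x => a b; rewrite ltcE/= => /andP[/eqP->]. Qed.

Lemma nbhs_normcP (z : Cplane R) (A : set (Cplane R)) :
  nbhs z A <-> exists2 e : R, 0 < e & forall y, normc (y - z) < e -> A y.
Proof.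
split => [/nbhs_ballP[e e0 eA]|[e e0 eA]].
  have e_re := gt0_ReE e0.
  exists (Re e); first by rewrite -ltcR -e_re.
  move=> y yz; apply: eA; rewrite -ball_normE/= distrC norm_normc e_re ltcR//.
apply/nbhs_ballP; exists e%:C; first by rewrite /= ltcR.
by move=> y; rewrite -ball_normE/= distrC norm_normc ltcR => /eA.
Qed.

Lemma open_normcP (A : set (Cplane R)) : open A <->
  forall z, A z -> exists2 e : R, 0 < e & forall y, normc (y - z) < e -> A y.
Proof.
rewrite openE; split => hA z Az; first exact/nbhs_normcP/hA.
by apply/nbhs_normcP; exact: hA.
Qed.

Lemma open_Re_preimage (B : set R) : open B -> open (Re @^-1` B : set (Cplane R)).
Proof.
rewrite openE => oB; apply/open_normcP => z Bz.
have /nbhs_ballP[e e0 eB] := oB _ Bz; exists e => // y yz.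
apply: eB; rewrite -ball_normE/= (le_lt_trans _ yz)// distrC.
by rewrite (le_trans _ (Re_le_normc _))// raddfB.
Qed.

Lemma open_Im_preimage (B : set R) : open B -> open (Im @^-1` B : set (Cplane R)).
Proof.
rewrite openE => oB; apply/open_normcP => z Bz.
have /nbhs_ballP[e e0 eB] := oB _ Bz; exists e => // y yz.
apply: eB; rewrite -ball_normE/= (le_lt_trans _ yz)// distrC.
by rewrite (le_trans _ (Im_le_normc _))// raddfB.
Qed.

End Normc.

Section BorelFun.
Context {R : realType} (U : set R).
Hypothesis mU : measurable U.
Implicit Types f g : R -> R[i].

(** An open subset of the plane is a countable union of squares with rational centres and sides, and
    the preimage of a square is an intersection of preimages of intervals under the two parts. *)
Lemma borel_funP f : borel_fun U f <->
  measurable_fun U (Re \o f) /\ measurable_fun U (Im \o f).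
Proof.
split.
  move=> mf; split.
  - apply: (measurability _ (measurable_realfun.RGenOpens.measurableE R)) => _ [_ [a [b ->]] <-].
    rewrite comp_preimage; apply: (mf mU); apply: sub_sigma_algebra.
    exact: open_Re_preimage.
  - apply: (measurability _ (measurable_realfun.RGenOpens.measurableE R)) => _ [_ [a [b ->]] <-].
    rewrite comp_preimage; apply: (mf mU); apply: sub_sigma_algebra.
    exact: open_Im_preimage.
move=> [mRe mIm].
apply: (@measurability _ _ _ (g_sigma_algebraType (@open (Cplane R))) U f
  (@open (Cplane R)) erefl) => _ [B oB <-].
pose Q q n : set R[i] := [set z | `|Re z - ratr q.1| < n.+1%:R^-1 /\
  `|Im z - ratr q.2| < n.+1%:R^-1].
have -> : U `&` f @^-1` B = \bigcup_(i : rat * rat * nat)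
    (if pselect (Q i.1 i.2 `<=` B) then U `&` f @^-1` Q i.1 i.2 else set0).
  apply/seteqP; split=> x /=; last first.
    by move=> [[q n] _]; case: pselect => // qB [Ux /qB].
  move=> [Ux Bfx]; have /open_normcP/(_ _ Bfx)[e e0 eB] := oB.
  (* Each part of z and of [f x] lies within 1/(n+1) of the same rational, so the difference has
     modulus below 4/(n+1). *)
  have e40 : 0 < e / 4 by rewrite divr_gt0.
  pose n := Num.truncn (e / 4)^-1.
  have n0 : 0 < n.+1%:R^-1 :> R by rewrite invr_gt0.
  have ne : n.+1%:R^-1 < e / 4.
    by rewrite invf_plt ?posrE// truncnS_gt.
  have qE (a : R) : exists q : rat, `|a - ratr q| < n.+1%:R^-1.
    have [//|q] := @rat_in_itvoo R (a - n.+1%:R^-1) (a + n.+1%:R^-1).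
      by rewrite ltrD2l gtrN.
    rewrite in_itv/= => /andP[q1 q2]; exists q.
    by rewrite ltr_distlC q1 q2.
  have [q1 hq1] := qE (Re (f x)); have [q2 hq2] := qE (Im (f x)).
  exists ((q1, q2), n) => //; case: pselect => //= nB.
  exfalso; apply: nB => z [z1 z2]; apply: eB.
  rewrite (le_lt_trans (normc_le_ReIm _))// !raddfB/=.
  have := ler_distD (ratr q1) (Re z) (Re (f x)).
  have := ler_distD (ratr q2) (Im z) (Im (f x)).
  rewrite -[`|ratr q2 - _|]distrC -[`|ratr q1 - _|]distrC.
  move: ne hq1 hq2 z1 z2 => /=; move: (n.+1%:R^-1 : R) => c h1 h2 h3 h4 h5 h6 h7; lra.
apply: countable_bigcupT_measurable => [|i]; first exact: countableP.
case: i => q n /=.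
case: pselect => [?|?] /=; last exact: measurable0.
rewrite (_ : _ `&` _ = (U `&` ((Re \o f) @^-1` (ball (ratr q.1 : R) n.+1%:R^-1 : set R))) `&`
    (U `&` ((Im \o f) @^-1` (ball (ratr q.2 : R) n.+1%:R^-1 : set R)))); last first.
  apply/seteqP; split => x /=; rewrite -!ball_normE /ball_/= !(distrC (ratr _)).
    by move=> [Ux [h1 h2]].
  by move=> [[Ux h1] [_ h2]].
by apply: measurableI; [apply: mRe|apply: mIm] => //; apply: open_measurable; exact: ball_open.
Qed.

End BorelFun.

(** * The space of square integrable functions *)

Section L2.
Context {R : realType} (mu : {measure set R -> \bar R}) (U : set R).
Hypothesis mU : measurable U.
Implicit Types f g m : R -> R[i].

Local Notation L2 := (square_integrable mu U).

(** [fine] sends an infinite norm to 0, so a bound on [nrm] is informative only together with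
    membership in [L2]; the lemmas below return both. *)
Definition nrm f : R := fine (L2norm mu f).

Lemma borel_normc f : borel_fun U f -> measurable_fun U (normc \o f).
Proof.
move=> /(borel_funP mU)[mRe mIm].
have -> : normc \o f = Num.sqrt \o
    ((fun x => (Re \o f) x ^+ 2) \+ (fun x => (Im \o f) x ^+ 2)).
  by apply/funext => x /=; case: (f x).
apply: (@measurableT_comp _ _ _ _ _ _ (@Num.sqrt R)).
  by apply: nondecreasing_measurable => // x y; exact: ler_wsqrtr.
by apply: measurable_funD; exact: measurable_funX.
Qed.

Lemma borel_lin a f g : borel_fun U f -> borel_fun U g ->
  borel_fun U (fun x => a * f x + g x).
Proof.
move=> /(borel_funP mU)[f1 f2] /(borel_funP mU)[g1 g2]; apply/(borel_funP mU); split.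
  have -> : Re \o (fun x => a * f x + g x) = (fun x =>
      Re a * (Re \o f) x - Im a * (Im \o f) x + (Re \o g) x).
    by apply/funext => x /=; case: a (f x) (g x) => [? ?] [? ?] [? ?].
  by apply: measurable_funD => //; apply: measurable_funB; exact: measurable_funM.
have -> : Im \o (fun x => a * f x + g x) = (fun x =>
    Re a * (Im \o f) x + Im a * (Re \o f) x + (Im \o g) x).
  by apply/funext => x /=; case: a (f x) (g x) => [? ?] [? ?] [? ?].
by apply: measurable_funD => //; apply: measurable_funD; exact: measurable_funM.
Qed.

Lemma borel_mul f g : borel_fun U f -> borel_fun U g ->
  borel_fun U (fun x => f x * g x).
Proof.
move=> /(borel_funP mU)[f1 f2] /(borel_funP mU)[g1 g2]; apply/(borel_funP mU); split.
  have -> : Re \o (fun x => f x * g x) = (fun x =>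
      (Re \o f) x * (Re \o g) x - (Im \o f) x * (Im \o g) x).
    by apply/funext => x /=; case: (f x) (g x) => [? ?] [? ?].
  by apply: measurable_funB; exact: measurable_funM.
have -> : Im \o (fun x => f x * g x) = (fun x =>
    (Re \o f) x * (Im \o g) x + (Im \o f) x * (Re \o g) x).
  by apply/funext => x /=; case: (f x) (g x) => [? ?] [? ?].
by apply: measurable_funD; exact: measurable_funM.
Qed.

Lemma borel_cst a : borel_fun U (fun=> a).
Proof. by apply/(borel_funP mU); split; exact: measurable_cst. Qed.

Lemma borel_limit (u : nat -> R -> R[i]) f : (forall n, borel_fun U (u n)) ->
  (forall x, U x -> normc (u n x - f x) @[n --> \oo] --> (0 : R)) ->
  borel_fun U f.
Proof.
move=> mu_ uf; apply/(borel_funP mU); split.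
  apply: (measurable_fun_cvg (h := fun n => Re \o u n)).
    by move=> n; have /(borel_funP mU)[] := mu_ n.
  move=> x Ux; apply/cvgrPdist_le => e e0.
  have /cvgrPdist_le/(_ e e0) := uf _ Ux; apply: filterS => n /=.
  rewrite sub0r normrN; apply: le_trans; rewrite distrC -raddfB.
  by rewrite (le_trans (Re_le_normc _))// ler_norm.
apply: (measurable_fun_cvg (h := fun n => Im \o u n)).
  by move=> n; have /(borel_funP mU)[] := mu_ n.
move=> x Ux; apply/cvgrPdist_le => e e0.
have /cvgrPdist_le/(_ e e0) := uf _ Ux; apply: filterS => n /=.
rewrite sub0r normrN; apply: le_trans; rewrite distrC -raddfB.
by rewrite (le_trans (Im_le_normc _))// ler_norm.
Qed.

Lemma measurable_sqr_normc f : borel_fun U f ->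
  measurable_fun U (fun x => ((normc (f x)) ^+ 2)%:E).
Proof.
by move=> mf; apply/measurable_EFinP; apply: measurable_funX; exact: borel_normc.
Qed.

Lemma L2norm_sqr f : fun_on U f ->
  ((L2norm mu f) `^ 2 = \int[mu]_(x in U) ((normc (f x)) ^+ 2)%:E)%E.
Proof.
move=> f0; rewrite /L2norm poweR_Lnorm; last by rewrite pnatr_eq0.
rewrite [RHS]integral_mkcond; apply: eq_integral => x _.
rewrite patchE; case: ifPn => [_|/negP xU].
  by rewrite /= powR_mulrn ?normr_ge0// ger0_norm// normc_ge0.
rewrite f0; last by move=> Ux; apply: xU; rewrite inE.
by rewrite Normc.normc0 /= normr0 powR0.
Qed.

Lemma L2norm_leP f B : fun_on U f -> 0 <= B -> (L2norm mu f <= B%:E)%E <->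
  (\int[mu]_(x in U) ((normc (f x)) ^+ 2)%:E <= (B ^+ 2)%:E)%E.
Proof.
move=> f0 B0; rewrite -(L2norm_sqr f0).
have -> : ((B ^+ 2)%:E = B%:E `^ 2)%E by rewrite /= powR_mulrn.
have N0 : (0 <= L2norm mu f)%E by exact: Lnorm_ge0.
have mono (r : R) (x y : \bar R) : 0 <= r -> (0 <= x -> x <= y -> x `^ r <= y `^ r)%E.
  move=> r0 x0 xy; apply: gt0_ler_poweR => //; rewrite in_itv/= leey andbT//.
  exact: le_trans xy.
split => h; first exact: mono.
have h2E : ((2 : R) * 2^-1 = 1)%R by rewrite divff.
rewrite -[leLHS]poweRe1// -[leRHS]poweRe1 ?lee_fin// -h2E !poweRrM.
by apply: mono; rewrite ?invr_ge0// poweR_ge0.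
Qed.

Lemma square_integrable_lty f : L2 f -> (L2norm mu f < +oo)%E.
Proof.
move=> [f0 mf]; rewrite -(L2norm_sqr f0); apply: lty_poweRy.
by rewrite pnatr_eq0.
Qed.

Lemma nrmE f : L2 f -> L2norm mu f = (nrm f)%:E.
Proof.
move=> L2f; rewrite /nrm fineK// ge0_fin_numE ?square_integrable_lty//.
exact: Lnorm_ge0.
Qed.

Lemma nrm_ge0 f : 0 <= nrm f.
Proof. by rewrite /nrm fine_ge0//; exact: Lnorm_ge0. Qed.

Lemma L2_le f B : fun_on U f -> borel_fun U f -> 0 <= B ->
  (\int[mu]_(x in U) ((normc (f x)) ^+ 2)%:E <= (B ^+ 2)%:E)%E ->
  L2 f /\ nrm f <= B.
Proof.
move=> f0 mf B0 h; have L2f : L2 f.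
  by split => //; apply: le_lt_trans h _; exact: ltey.
split => //; rewrite -lee_fin -nrmE//.
exact/(L2norm_leP f0 B0).
Qed.

Lemma L2_int_le f B : L2 f -> nrm f <= B ->
  (\int[mu]_(x in U) ((normc (f x)) ^+ 2)%:E <= (B ^+ 2)%:E)%E.
Proof.
move=> L2f fB; have B0 : 0 <= B by rewrite (le_trans _ fB)// nrm_ge0.
have [f0 _ _] := L2f.
by apply/(L2norm_leP f0 B0); rewrite nrmE// lee_fin.
Qed.

(** Scalars, truncations and resolvents all act on L2 as bounded Borel multipliers. *)
Lemma L2_mul m f B : 0 <= B -> borel_fun U m -> (forall x, U x -> normc (m x) <= B) ->
  L2 f -> L2 (fun x => m x * f x) /\ nrm (fun x => m x * f x) <= B * nrm f.
Proof.
move=> B0 mm mB L2f; have [f0 mf _] := L2f.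
apply: L2_le => //.
- by move=> x /f0 ->; rewrite mulr0.
- exact: borel_mul.
- by rewrite mulr_ge0// nrm_ge0.
rewrite exprMn EFinM.
apply: (@le_trans _ _ ((B ^+ 2)%:E * \int[mu]_(x in U) ((normc (f x)) ^+ 2)%:E)%E).
  rewrite -ge0_integralZl_EFin//; last 3 first.
    by move=> x _; rewrite lee_fin sqr_ge0.
    exact: measurable_sqr_normc.
    exact: sqr_ge0.
  apply: ge0_le_integral => //.
  - by move=> x _; rewrite lee_fin sqr_ge0.
  - by apply: measurable_sqr_normc; exact: borel_mul.
  - by apply: emeasurable_funM => //; exact: measurable_sqr_normc.
  move=> x Ux; rewrite -EFinM lee_fin Normc.normcM exprMn.
  by rewrite ler_wpM2r ?sqr_ge0// lerXn2r ?nnegrE ?normc_ge0// mB.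
by rewrite lee_wpmul2l ?lee_fin ?sqr_ge0//; exact: L2_int_le.
Qed.

Lemma measurable_normcT f : L2 f -> measurable_fun setT (normc \o f).
Proof.
move=> [f0 mf _]; have -> : normc \o f = (normc \o f) \_ U.
  apply/funext => x; rewrite patchE; case: ifPn => // /negP xU /=.
  by rewrite f0 ?Normc.normc0// => Ux; apply: xU; rewrite inE.
by apply/(measurable_restrict _ mU measurableT); rewrite setTI; exact: borel_normc.
Qed.

Lemma L2_add f g : L2 f -> L2 g ->
  L2 (fun x => f x + g x) /\ nrm (fun x => f x + g x) <= nrm f + nrm g.
Proof.
move=> L2f L2g; have [f0 mf _] := L2f; have [g0 mg _] := L2g.
have fg0 : fun_on U (fun x => f x + g x) by move=> x Ux; rewrite f0// g0// addr0.
have mfg : borel_fun U (fun x => f x + g x).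
  have -> : (fun x => f x + g x) = (fun x => 1 * f x + g x).
    by apply/funext => x; rewrite mul1r.
  exact: borel_lin.
apply: L2_le => //; first by rewrite addr_ge0// nrm_ge0.
have N0 : 0 <= nrm f + nrm g by rewrite addr_ge0// nrm_ge0.
have := minkowski_EFin mu (measurable_normcT L2f) (measurable_normcT L2g) (ler1n _ 2).
rewrite -[X in (_ <= X + _)%E]/(L2norm mu f) -[X in (_ <= _ + X)%E]/(L2norm mu g).
rewrite !nrmE// -EFinD => mink.
(* Minkowski controls the sum of the moduli; coding it as a complex function lets [L2norm_leP]
   convert the bound to integrals. *)
pose h x : R[i] := (normc (f x) + normc (g x))%:C.
have normch x : normc (h x) = normc (f x) + normc (g x).
  by rewrite normcR ger0_norm// addr_ge0// normc_ge0.
have h0 : fun_on U h.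
  by move=> x Ux; rewrite /h f0// g0// Normc.normc0 addr0.
have hN : (L2norm mu h <= (nrm f + nrm g)%:E)%E.
  by rewrite /L2norm; under eq_Lnorm do rewrite normch.
apply: le_trans ((L2norm_leP h0 N0).1 hN).
apply: ge0_le_integral => //.
- by move=> x _; rewrite lee_fin sqr_ge0.
- exact: measurable_sqr_normc.
- apply/measurable_EFinP; apply: measurable_funX.
  rewrite (_ : (fun x => _) = (normc \o f) \+ (normc \o g)); last first.
    by apply/funext => x; rewrite normch.
  by apply: measurable_funD; exact: borel_normc.
move=> x Ux; rewrite lee_fin normch lerXn2r ?nnegrE ?addr_ge0 ?normc_ge0//.
exact: normcD.
Qed.

Lemma nrmZ a f : L2 f -> nrm (fun x => a * f x) <= normc a * nrm f.
Proof.
by move=> /(L2_mul (normc_ge0 a) (borel_cst a) (fun x _ => lexx _))[].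
Qed.

(** Fatou applied to the squared moduli. Bounded evaluations supply pointwise limits, so this takes
    the place of completeness of L2. *)
Lemma L2_limit (u : nat -> R -> R[i]) f B : 0 <= B -> fun_on U f ->
  (forall n, L2 (u n) /\ nrm (u n) <= B) ->
  (forall x, U x -> normc (u n x - f x) @[n --> \oo] --> (0 : R)) ->
  L2 f /\ nrm f <= B.
Proof.
move=> B0 f0 uB uf.
have mf : borel_fun U f.
  by apply: borel_limit uf => n; have [[]] := uB n.
apply: L2_le => //.
pose s n x := ((normc (u n x)) ^+ 2)%:E.
have ms n : measurable_fun U (s n).
  by apply: measurable_sqr_normc; have [[]] := uB n.
have s0 n x : U x -> (0 <= s n x)%E by move=> _; rewrite lee_fin sqr_ge0.
have := fatou mu mU ms s0.
have -> : (\int[mu]_(x in U) limn_einf (s^~ x) =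
           \int[mu]_(x in U) ((normc (f x)) ^+ 2)%:E)%E.
  apply: eq_integral => x; rewrite inE => Ux.
  suff c : s n x @[n --> \oo] --> ((normc (f x)) ^+ 2)%:E.
    by rewrite (cvg_limn_einf_sup c).1.
  apply: cvg_EFin; first exact: nearW.
  have ufx : normc (u n x) @[n --> \oo] --> normc (f x).
    apply/cvgrPdist_le => e e0.
    have /cvgrPdist_le/(_ e e0) := uf _ Ux; apply: filterS => n /=.
    rewrite sub0r normrN; apply: le_trans.
    have h1 := normcD (u n x - f x) (f x); rewrite subrK in h1.
    have h2 := normcD (f x - u n x) (u n x); rewrite subrK normcB in h2.
    by rewrite [leRHS]ger0_norm ?normc_ge0// ler_norml; apply/andP; split; lra.
  exact: (cvgM ufx ufx).
move=> /le_trans; apply.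
rewrite limn_einf_lim; apply: lime_le; first exact: is_cvg_einfs.
apply: nearW => n; apply: le_trans (L2_int_le (uB n).1 (uB n).2).
by apply: ereal_inf_lbound; exists n => /=.
Qed.

End L2.

(** * Sequences with geometrically decreasing steps *)

Section Limits.
Context {R : realType}.

Lemma cvg_half (B : R) : (fun n => B * 2^-1 ^+ n) @ \oo --> (0 : R).
Proof.
rewrite -[X in _ --> X](mulr0 B); apply: cvgMr; apply: cvg_expr.
by rewrite ger0_norm ?invr_ge0// invf_lt1 ?ltr1n.
Qed.

Lemma geometric_cauchy_real (v : nat -> R) (B : R) :
  (forall n m, `|v (n + m)%N - v n| <= B * 2^-1 ^+ n) -> cvgn v.
Proof.
move=> vB; apply: cauchy_cvg; apply/cauchy_exP => e e0.
have := cvg_half B.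
move=> /cvgrPdist_lt/(_ e e0)[N _ hN].
exists (v N), N => // n /= Nn; rewrite -ball_normE/= distrC.
rewrite -(subnKC Nn) (le_lt_trans (vB _ _))//.
by have := hN N (leqnn N); rewrite sub0r normrN; apply: le_lt_trans; exact: ler_norm.
Qed.

Lemma geometric_cauchy_complex (v : nat -> R[i]) (B : R) :
  (forall n m, normc (v (n + m)%N - v n) <= B * 2^-1 ^+ n) ->
  exists l, normc (v n - l) @[n --> \oo] --> (0 : R).
Proof.
move=> vB.
have /cvg_ex[a va] : cvgn (Re \o v).
  apply: (geometric_cauchy_real (B := B)) => n m /=.
  by rewrite -raddfB (le_trans (Re_le_normc _)).
have /cvg_ex[b vb] : cvgn (Im \o v).
  apply: (geometric_cauchy_real (B := B)) => n m /=.
  by rewrite -raddfB (le_trans (Im_le_normc _)).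
exists (Complex a b); apply/cvgrPdist_lt => e e0.
have e20 : 0 < e / 2 by rewrite divr_gt0.
move/cvgrPdist_lt : va => /(_ _ e20) va; move/cvgrPdist_lt : vb => /(_ _ e20) vb.
near=> n; rewrite sub0r normrN ger0_norm ?normc_ge0//.
rewrite (le_lt_trans (normc_le_ReIm _))// !raddfB/= (splitr e) ltrD// distrC.
  by near: n.
by near: n.
Unshelve. all: by end_near. Qed.

End Limits.

(** * Reproducing kernel subspaces *)

Section RKS.
Context {R : realType} (mu : {measure set R -> \bar R}) (U : set R).
Hypothesis mU : measurable U.
Context (H : set (R -> R[i])).
Hypothesis H_rks : reproducing_kernel_subspace mu U H.
Implicit Types f g h : R -> R[i].

Local Notation L2 := (square_integrable mu U).
Local Notation nrm := (nrm mu).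

Lemma nrm_ae f g : L2 f -> L2 g -> {ae mu, forall x, U x -> f x = g x} ->
  nrm f = nrm g.
Proof.
move=> L2f L2g fg; have [f0 mf _] := L2f; have [g0 mg _] := L2g.
have fgE : (\int[mu]_(x in U) ((normc (f x)) ^+ 2)%:E =
    \int[mu]_(x in U) ((normc (g x)) ^+ 2)%:E)%E.
  apply: ge0_ae_eq_integral => //.
  - exact: measurable_sqr_normc.
  - exact: measurable_sqr_normc.
  - by move=> x _; rewrite lee_fin sqr_ge0.
  - by move=> x _; rewrite lee_fin sqr_ge0.
  by apply: filterS fg => x fgx Ux; rewrite fgx.
apply/eqP; rewrite eq_le; apply/andP; split.
  apply: (L2_le f0 mf (nrm_ge0 mu g) _).2; rewrite fgE.
  exact: L2_int_le (lexx _).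
apply: (L2_le g0 mg (nrm_ge0 mu f) _).2; rewrite -fgE.
exact: L2_int_le (lexx _).
Qed.

Lemma nrm0 : nrm (fun=> 0) = 0.
Proof.
rewrite /nrm /L2norm; under eq_Lnorm do rewrite Normc.normc0.
by rewrite Lnorm0//= eqe pnatr_eq0.
Qed.

Lemma H_L2 f : H f -> L2 f. Proof. exact: rks_sub. Qed.

Lemma H_off f x : H f -> ~ U x -> f x = 0.
Proof. by move=> /H_L2[f0 _ _]; exact: f0. Qed.

Lemma H_add f g : H f -> H g -> H (fun x => f x + g x).
Proof.
move=> Hf Hg; rewrite (_ : (fun x => _) = (fun x => 1 * f x + g x)).
  exact: (rks_lin H_rks).
by apply/funext => x; rewrite mul1r.
Qed.

Lemma H_scale a f : H f -> H (fun x => a * f x).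
Proof.
move=> Hf; rewrite (_ : (fun x => _) = (fun x => a * f x + 0)).
  by apply: (rks_lin H_rks) => //; exact: (rks_zero H_rks).
by apply/funext => x; rewrite addr0.
Qed.

Lemma H_sub f g : H f -> H g -> H (fun x => f x - g x).
Proof.
move=> Hf Hg; rewrite (_ : (fun x => _) = (fun x => -1 * g x + f x)).
  exact: (rks_lin H_rks).
by apply/funext => x; rewrite mulN1r addrC.
Qed.

Lemma nrmB f g : L2 f -> L2 g -> L2 (fun x => f x - g x) /\
  nrm (fun x => f x - g x) <= nrm f + nrm g.
Proof.
move=> L2f L2g; have L2N : L2 (fun x => -1 * g x).
  exact: (L2_mul mU (normc_ge0 (-1)) (borel_cst mU (-1)) (fun x _ => lexx _) L2g).1.
have := nrmZ mU (-1) L2g; rewrite normcN Normc.normc1 mul1r => gN.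
have -> : (fun x => f x - g x) = (fun x => f x + -1 * g x).
  by apply/funext => x; rewrite mulN1r.
have [? h] := L2_add mU L2f L2N; split => //.
by rewrite (le_trans h)// lerD2l.
Qed.

Lemma nrmBC f g : L2 f -> L2 g -> nrm (fun x => f x - g x) = nrm (fun x => g x - f x).
Proof.
have le f' g' : L2 f' -> L2 g' -> nrm (fun x => f' x - g' x) <= nrm (fun x => g' x - f' x).
  move=> L2f L2g; have := nrmZ mU (-1) (nrmB L2g L2f).1.
  rewrite normcN Normc.normc1 mul1r; under eq_fun do rewrite mulN1r opprB.
  by [].
by move=> L2f L2g; apply/eqP; rewrite eq_le !le.
Qed.

Lemma H_eval k : U k -> exists2 C : R, 0 <= C &
  forall f, H f -> normc (f k) <= C * nrm f.
Proof.
move=> Uk; have [C hC] := rks_eval H_rks Uk.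
exists (Num.max C 0); first by rewrite le_max lexx orbT.
move=> f Hf; have := hC f Hf; rewrite (nrmE (H_L2 Hf)).
rewrite -EFinM lee_fin => /le_trans; apply.
by rewrite ler_wpM2r ?nrm_ge0// le_max lexx.
Qed.

(** Bounded evaluations turn vanishing norm into vanishing at every point of [U]; off [U]
    representatives are 0. *)
Lemma nrm_eq0 f : H f -> nrm f <= 0 -> forall x, f x = 0.
Proof.
move=> Hf f0 x; have [Ux|Ux] := pselect (U x); last exact: H_off.
have [C C0 /(_ f Hf)] := H_eval Ux.
have -> : nrm f = 0 by apply/eqP; rewrite eq_le f0 nrm_ge0.
rewrite mulr0 => fx0; apply/eqP; rewrite -[_ == _]negbK -normc_gt0 -leNgt //.
Qed.

(** Bounded evaluations give a pointwise limit, Fatou gives its rate, and closedness replaces it by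
    an element of [H] equal to it almost everywhere. The factor 2 is the sum of the geometric
    series. *)
Lemma H_complete (u : nat -> R -> R[i]) A : (forall n, H (u n)) ->
  (forall n, nrm (fun x => u n.+1 x - u n x) <= A * 2^-1 ^+ n) ->
  exists2 g, H g & forall n, nrm (fun x => g x - u n x) <= 2 * A * 2^-1 ^+ n.
Proof.
move=> Hu uA.
have A0 : 0 <= A by have := uA 0; rewrite expr0 mulr1; apply: le_trans; exact: nrm_ge0.
have uB n m : nrm (fun x => u (n + m)%N x - u n x) <= 2 * A * 2^-1 ^+ n.
  (* The factor 1 - 2^-m comes from the exact partial sum, so that the induction on [m] closes. *)
  suff : nrm (fun x => u (n + m)%N x - u n x) <=
      2 * A * 2^-1 ^+ n * (1 - 2^-1 ^+ m).
    have p0 k : 0 <= 2^-1 ^+ k :> R by rewrite exprn_ge0// invr_ge0.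
    move=> /le_trans; apply; rewrite ler_piMr ?gerBl//.
    by rewrite mulr_ge0// mulr_ge0.
  elim: m => [|m ih].
    rewrite addn0 expr0 subrr mulr0; under eq_fun do rewrite subrr.
    by rewrite nrm0.
  have -> : (fun x => u (n + m.+1)%N x - u n x) =
      (fun x => (u (n + m).+1 x - u (n + m)%N x) + (u (n + m)%N x - u n x)).
    by apply/funext => x; rewrite addnS subrKA.
  have h1 := H_L2 (H_sub (Hu (n + m).+1) (Hu (n + m)%N)).
  have h2 := H_L2 (H_sub (Hu (n + m)%N) (Hu n)).
  apply: le_trans (L2_add mU h1 h2).2 _.
  apply: le_trans (lerD (uA _) ih) _.
  rewrite exprD exprS; set p := _ ^+ n; set q := _ ^+ m.
  by rewrite le_eqVlt; apply/orP; left; apply/eqP; field.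
have cvgu x : exists l, (U x -> normc (u n x - l) @[n --> \oo] --> (0 : R)) /\
    (~ U x -> l = 0).
  have [Ux|Ux] := pselect (U x); last by exists 0; split.
  have [C C0 hC] := H_eval Ux.
  have [|l ul] := @geometric_cauchy_complex _ (u ^~ x) (C * (2 * A)).
    move=> n m; rewrite -mulrA; apply: le_trans (hC _ (H_sub (Hu _) (Hu _))) _.
    by rewrite ler_wpM2l.
  by exists l; split.
have [f fP] := choice cvgu.
have f0 : fun_on U f by move=> x; exact: (fP x).2.
have fB n : L2 (fun x => f x - u n x) /\ nrm (fun x => f x - u n x) <= 2 * A * 2^-1 ^+ n.
  apply: (@L2_limit _ _ _ mU (fun m x => u (n + m)%N x - u n x)).
  - by rewrite !mulr_ge0// exprn_ge0// invr_ge0.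
  - by move=> x Ux; rewrite f0// (H_off (Hu n))// subrr.
  - by move=> m; split; [exact/H_L2/H_sub|exact: uB].
  move=> x Ux; have := (fP x).1 Ux; rewrite -(cvg_shiftn n) => c.
  by under eq_cvg do rewrite opprB addrA subrK addnC.
have L2f : L2 f.
  rewrite (_ : f = fun x => (f x - u 0 x) + u 0 x); last first.
    by apply/funext => x; rewrite subrK.
  by apply: (L2_add mU _ _).1; [have [] := fB 0|exact: H_L2].
have [|g Hg gf] := rks_closed H_rks Hu L2f.
  have -> : (fun n => L2norm mu (fun x => u n x - f x)) =
      (fun n => (nrm (fun x => f x - u n x))%:E).
    apply/funext => n; rewrite nrmBC//; last exact: H_L2.
    by rewrite (nrmE (nrmB (H_L2 (Hu n)) L2f).1).
  apply: cvg_EFin; first exact: nearW.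
  apply: (@squeeze_cvgr _ _ _ _ (fun=> 0) (fun n => 2 * A * 2^-1 ^+ n)).
  - by apply: nearW => n; rewrite nrm_ge0 (fB n).2.
  - exact: cvg_cst.
  exact: cvg_half.
exists g => // n; rewrite (nrm_ae (g := fun x => f x - u n x)); first exact: (fB n).2.
- exact/H_L2/H_sub.
- exact: (fB n).1.
by apply: filterS gf => x gfx Ux; rewrite gfx.
Qed.

(* [v] may agree almost everywhere with an element of [H] without belonging to
   [H]; the evaluation at [k] separates it from [H] in that case. *)
Lemma H_dist_gt0 v : U !=set0 -> L2 v -> ~ H v ->
  exists k, U k /\ exists2 d : R, 0 < d &
    forall h, H h -> d <= nrm (fun x => v x - h x) + normc (v k - h k).
Proof.
move=> [k0 Uk0] L2v Hv.
have [[g Hg gv]|noae] := pselect (exists2 g, H g & {ae mu, forall x, U x -> g x = v x}).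
  have [k [Uk gvk]] : exists k, U k /\ g k <> v k.
    apply: contrapT => gvU; apply: Hv; rewrite (_ : v = g)//; apply/funext => x.
    have [Ux|Ux] := pselect (U x); last by rewrite (H_off Hg)//; case: L2v => ->.
    by apply: contrapT => vgx; apply: gvU; exists x; split => // /esym.
  exists k; split => //; have [C C0 hC] := H_eval Uk.
  have C10 : 0 < C + 1 by rewrite ltr_wpDl.
  (* |v k - g k| is at most |v k - h k| plus C times the norm of g - h, which is the norm of v - h
     because g = v almost everywhere. *)
  exists (normc (v k - g k) / (C + 1)).
    by rewrite divr_gt0// normc_gt0 subr_eq0; apply/eqP => /esym.
  move=> h Hh; rewrite ler_pdivrMr//.
  have -> : nrm (fun x => v x - h x) = nrm (fun x => g x - h x).
    apply: nrm_ae; [exact: (nrmB _ (H_L2 Hh)).1|exact/H_L2/H_sub|].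
    by apply: filterS gv => x gvx Ux; rewrite gvx.
  have := hC _ (H_sub Hg Hh); have := normcD (v k - h k) (h k - g k).
  rewrite subrKA [normc (h k - g k)]normcB.
  have := nrm_ge0 mu (fun x => g x - h x); have := normc_ge0 (v k - h k).
  nra.
(* Without a positive distance, elements of [H] within 1/(n+1) of [v] converge to it, and closedness
   gives the representative just excluded. *)
exists k0; split => //; apply: contrapT => noD; apply: noae.
have hn n : exists h, H h /\ nrm (fun x => v x - h x) < n.+1%:R^-1.
  apply: contrapT => no; apply: noD; exists n.+1%:R^-1; first by rewrite invr_gt0.
  move=> h Hh; rewrite leNgt; apply/negP => lt; apply: no; exists h; split => //.
  by apply: le_lt_trans lt; rewrite lerDl normc_ge0.
have [u uP] := choice hn.
apply: (rks_closed H_rks (u := u)) => //; first by move=> n; have [] := uP n.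
have -> : (fun n => L2norm mu (fun x => u n x - v x)) =
    (fun n => (nrm (fun x => v x - u n x))%:E).
  apply/funext => n; have [/H_L2 L2u _] := uP n.
  by rewrite nrmBC// (nrmE (nrmB L2u L2v).1).
apply: cvg_EFin; first exact: nearW.
apply: (@squeeze_cvgr _ _ _ _ (fun=> 0) (fun n => n.+1%:R^-1)).
- by apply: nearW => n; rewrite nrm_ge0 ltW// (uP n).2.
- exact: cvg_cst.
exact: cvg_harmonic.
Qed.

(** On the support of [far k n] the factor 1 / (x - k) has modulus at most n + 1. *)
Definition far (k : R) n : R -> R[i] :=
  fun x => (\1_[set x | n.+1%:R^-1 <= `|x - k|] x)%:C.

Lemma farE k n x : far k n x = (n.+1%:R^-1 <= `|x - k|)%R%:R.
Proof.
rewrite /far indicE; case: (boolP (_ <= _)) => h; first by rewrite mem_set.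
by rewrite memNset//; exact/negP.
Qed.

Lemma borel_far k n : borel_fun U (far k n).
Proof.
apply/(borel_funP mU); split; last exact: measurable_cst.
apply: measurable_indic; rewrite (_ : [set x | _] = ~` ball k n.+1%:R^-1).
  by apply: measurableC; exact: measurable_ball.
apply/seteqP; split => x /=; rewrite -ball_normE /ball_/= distrC.
  by move=> h; apply/negP; rewrite -leNgt.
by move/negP; rewrite -leNgt.
Qed.

Lemma nrm_far k n h : L2 h -> L2 (fun x => far k n x * h x) /\
  nrm (fun x => far k n x * h x) <= nrm h.
Proof.
rewrite -[nrm h]mul1r; apply: L2_mul => //; first exact: borel_far.
by move=> x _; rewrite farE; case: (n.+1%:R^-1 <= _); rewrite ?Normc.normc1 ?Normc.normc0.
Qed.

(** The truncations converge pointwise to [h] with its value at [k] replaced by 0, a change on a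
    null set. *)
Lemma nrm_far_le k h B : mu [set k] = 0%E -> 0 <= B -> L2 h ->
  (forall n, nrm (fun x => far k n x * h x) <= B) -> nrm h <= B.
Proof.
move=> muk B0 L2h hB; pose f x := if x == k then 0 else h x.
have f0 : fun_on U f.
  by move=> x Ux; rewrite /f; case: ifP => // _; have [->] := L2h.
have [|L2f fB] := @L2_limit _ mu _ mU (fun n x => far k n x * h x) f B B0 f0
    (fun n => conj (nrm_far k n L2h).1 (hB n)).
  move=> x Ux; apply/cvgrPdist_lt => e e0.
  exists (Num.truncn `|x - k|^-1) => //= n hn; rewrite sub0r normrN farE /f.
  case: eqVneq => [->|xk].
    by rewrite subrr normr0 invr_le0 leNgt ltr0n/= mul0r subrr Normc.normc0 normr0.
  have xk0 : 0 < `|x - k| by rewrite normr_gt0 subr_eq0.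
  rewrite invf_ple ?posrE// (le_trans (ltW (truncnS_gt _))) ?ler_nat ?ltnS//.
  by rewrite mul1r subrr Normc.normc0 normr0.
rewrite (nrm_ae (g := f))//; exists [set k]; split => //.
move=> x /= nx; apply: contrapT => /eqP xk; apply: nx => Ux.
by rewrite /f (negbTE xk).
Qed.

End RKS.

(** * Uniform boundedness *)

Section Sokal.
Context {R : realType} (mu : {measure set R -> \bar R}) (U : set R).
Hypothesis mU : measurable U.
Context (H : set (R -> R[i])).
Hypothesis H_rks : reproducing_kernel_subspace mu U H.
Implicit Types f g h : R -> R[i].
Local Notation L2 := (square_integrable mu U).
Local Notation nrm := (nrm mu).

(** The geometric rate is used only to pass to the limit, so a sharper bound [K] on the later
    differences survives unchanged. *)
Lemma H_tail_le (u : nat -> R -> R[i]) g A K n : (forall n, H (u n)) -> H g ->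
  (forall n, nrm (fun x => g x - u n x) <= A * 2^-1 ^+ n) ->
  (forall m, nrm (fun x => u (n + m)%N x - u n x) <= K) ->
  nrm (fun x => g x - u n x) <= K.
Proof.
move=> Hu Hg gu uK; apply/ler_addgt0Pr => e e0.
have := cvg_half A.
move=> /cvgrPdist_lt/(_ e e0)[N _ hN].
have := hN (n + N)%N (leq_addl _ _); rewrite sub0r normrN => /ltW/(le_trans (ler_norm _)).
move=> /(le_trans (gu _)) gN.
have -> : (fun x => g x - u n x) =
    (fun x => (u (n + N)%N x - u n x) + (g x - u (n + N)%N x)).
  by apply/funext => x; rewrite [RHS]addrC subrKA.
apply: le_trans (L2_add mU _ _).2 _; try exact/(H_L2 H_rks)/(H_sub H_rks).
by rewrite lerD.
Qed.

Section Seminorm.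
Variable p : (R -> R[i]) -> R.
Hypothesis pD : forall f g, H f -> H g -> p (fun x => f x + g x) <= p f + p g.
Hypothesis pZ : forall (a : R[i]) f, H f -> p (fun x => a * f x) <= normc a * p f.

Lemma seminorm0 : p (fun=> 0) = 0.
Proof.
have H0 := rks_zero H_rks; apply/eqP; rewrite eq_le; apply/andP; split.
  by have := pZ 0 H0; rewrite Normc.normc0 !mul0r.
have := pD H0 H0; rewrite addr0.
by rewrite -[leLHS]addr0 lerD2l.
Qed.

(** 2y is the difference of f + y and f - y, so the two values of [p] add up to at least 2 p(y). *)
Lemma seminorm_max f y : H f -> H y ->
  p y <= p (fun x => f x + y x) \/ p y <= p (fun x => f x - y x).
Proof.
move=> Hf Hy; have h1 := pD (H_add H_rks Hf Hy) (H_scale H_rks (-1) (H_sub H_rks Hf Hy)).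
have h2 := pZ (-1) (H_sub H_rks Hf Hy); rewrite normcN Normc.normc1 mul1r in h2.
have h3 := pZ (2^-1) (H_scale H_rks 2 Hy).
have e3 : (fun x => 2^-1 * (2 * y x)) = y.
  by apply/funext => x; rewrite mulrA mulVf ?mul1r// pnatr_eq0.
have e1 : (fun x => f x + y x + -1 * (f x - y x)) = (fun x => 2 * y x).
  by apply/funext => x; ring.
rewrite e3 Normc.normcV (_ : 2 = 2%:C) ?normcR ?ger0_norm// in h3; last first.
  by rewrite rmorph_nat.
rewrite e1 in h1.
have [|] := leP (p y) (p (fun x => f x + y x)); first by left.
move=> h4; right; rewrite rmorph_nat in h3; lra.
Qed.

(** [S] is the operator norm, the supremum of [p] over the unit ball; 3/4 is the fraction attained
    by a near-maximiser. *)
Lemma seminorm_sup B : (forall f, H f -> p f <= B * nrm f) ->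
  exists2 S, 0 <= S & (forall f, H f -> p f <= S * nrm f) /\
    exists y, [/\ H y, nrm y <= 1 & S * (3 / 4) <= p y].
Proof.
move=> pB; have H0 := rks_zero H_rks.
pose E := [set p f | f in [set f | H f /\ nrm f <= 1]].
have E0 : E 0 by exists (fun=> 0); rewrite ?seminorm0//; split; rewrite ?nrm0.
have supE : has_sup E.
  split; first by exists 0.
  exists (Num.max B 0) => _ [f [Hf f1] <-]; apply: le_trans (pB _ Hf) _.
  have [B0|B0] := leP 0 B; first by rewrite ler_piMr.
  by rewrite mulr_le0_ge0 ?nrm_ge0// ltW.
have S0 : 0 <= sup E by apply: ub_le_sup => //; case: supE.
exists (sup E) => //; split.
  move=> f Hf; have [f0|f0] := leP (nrm f) 0.
    have -> : f = fun=> 0 by apply/funext => x; exact: (nrm_eq0 H_rks).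
    by rewrite seminorm0 nrm0 mulr0.
  rewrite mulrC -ler_pdivrMl//; pose a : R[i] := (nrm f)^-1%:C.
  have na : normc a = (nrm f)^-1 by rewrite normcR ger0_norm// invr_ge0 ltW.
  have Ha := H_scale H_rks a Hf.
  have h : p (fun x => a * f x) <= sup E.
    apply: ub_le_sup; first by case: supE.
    exists (fun x => a * f x) => //; split => //.
    apply: le_trans (nrmZ mU _ (H_L2 H_rks Hf)) _.
    by rewrite na mulVf// gt_eqF.
  apply: le_trans h; have := pZ (nrm f)%:C Ha.
  rewrite normcR ger0_norm ?nrm_ge0// -ler_pdivrMl//.
  suff -> : (fun x => (nrm f)%:C * (a * f x)) = f by [].
  apply/funext => x; rewrite mulrA -rmorphM divff ?mul1r// gt_eqF//.
have [S00|S1] := leP (sup E) 0.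
  exists (fun=> 0); split => //; first by rewrite nrm0.
  by rewrite seminorm0; lra.
have S40 : 0 < sup E / 4 by rewrite divr_gt0.
have [_ [y [Hy y1] <-] hy] := sup_adherent S40 supE.
by exists y; split => //; lra.
Qed.

End Seminorm.

(* The elementary proof of the uniform boundedness principle due to Sokal. *)
Lemma uniform_boundedness (p : nat -> (R -> R[i]) -> R) :
  (forall n f g, H f -> H g -> p n (fun x => f x + g x) <= p n f + p n g) ->
  (forall n (a : R[i]) f, H f -> p n (fun x => a * f x) <= normc a * p n f) ->
  (forall n, exists B, forall f, H f -> p n f <= B * nrm f) ->
  (forall f, H f -> exists B, forall n, p n f <= B) ->
  exists2 B, 0 <= B & forall n f, H f -> p n f <= B * nrm f.
Proof.
move=> pD pZ pB pb; apply: contrapT => noB.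
have Sex n : exists S, [/\ 0 <= S, (forall f, H f -> p n f <= S * nrm f) &
    exists y, [/\ H y, nrm y <= 1 & S * (3 / 4) <= p n y]].
  by have [B /(seminorm_sup (pD n) (pZ n))[S S0 [? ?]]] := pB n; exists S.
(* If no uniform bound exists, some seminorm has operator norm exceeding (j + 1) 4^j. *)
have big j : exists ny : nat * (R -> R[i]), [/\ H ny.2, nrm ny.2 <= 1 & exists S,
    [/\ j.+1%:R * 4 ^+ j <= S, S * (3 / 4) <= p ny.1 ny.2 &
      forall f, H f -> p ny.1 f <= S * nrm f]].
  apply: contrapT => no; apply: noB; exists (j.+1%:R * 4 ^+ j).
    by rewrite mulr_ge0// exprn_ge0.
  move=> n f Hf; have [S [S0 hS [y [Hy y1 Sy]]]] := Sex n.
  apply: le_trans (hS _ Hf) _; rewrite ler_wpM2r ?nrm_ge0// leNgt.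
  apply/negP => /ltW lt; apply: no; exists (n, y); split => //.
  by exists S; split.
have [ny nyP] := choice big.
pose y j x := (4^-1 ^+ j)%:C * (ny j).2 x.
have Hy j : H (y j) by have [Hny _ _] := nyP j; exact: (H_scale H_rks _ Hny).
have yB j : nrm (y j) <= 4^-1 ^+ j.
  have [/(H_L2 H_rks) Ly y1 _] := nyP j.
  apply: le_trans (nrmZ mU _ Ly) _.
  by rewrite normcR ger0_norm ?ler_piMr// exprn_ge0// invr_ge0.
(* The sign is chosen so that the seminorm of the new partial sum is at least that of [y j] alone,
   whatever was added before. *)
pose step j f : R -> R[i] :=
  if p (ny j).1 (y j) <= p (ny j).1 (fun x => f x + y j x)
  then (fun x => f x + y j x) else (fun x => f x - y j x).
pose u := fix u j := if j is j'.+1 then step j' (u j') else fun=> 0.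
have Hstep j f : H f -> H (step j f).
  by move=> Hf; rewrite /step; case: ifP => _; [exact: (H_add H_rks)|exact: (H_sub H_rks)].
have Hu j : H (u j).
  by elim: j => [|j ih]; [exact: (rks_zero H_rks)|exact: Hstep].
have u_step j : nrm (fun x => u j.+1 x - u j x) <= 4^-1 ^+ j.
  rewrite /= /step; case: ifP => _.
    by under eq_fun do rewrite addrC addKr.
  rewrite (nrmBC mU (H_L2 H_rks (H_sub H_rks (Hu j) (Hy j))) (H_L2 H_rks (Hu j))).
  by under eq_fun do rewrite subKr.
have p_step j : p (ny j).1 (y j) <= p (ny j).1 (u j.+1).
  rewrite /= /step; case: ifPn => // no.
  by have [h|//] := seminorm_max (pD (ny j).1) (pZ (ny j).1) (Hu j) (Hy j); rewrite h in no.
have [|g Hg gu] := H_complete mU H_rks Hu (A := 1).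
  move=> n; rewrite mul1r (le_trans (u_step n))// lerXn2r ?nnegrE ?invr_ge0//.
  by rewrite lef_pV2 ?posrE// ler_nat.
(* The terms after [y j] have norms at most 4^-i for i > j, with sum 4^-j / 3. *)
have tail j : nrm (fun x => g x - u j.+1 x) <= 4^-1 ^+ j / 3.
  apply: H_tail_le Hg gu _ => // m.
  suff : nrm (fun x => u (j.+1 + m)%N x - u j.+1 x) <=
      4^-1 ^+ j / 3 * (1 - 4^-1 ^+ m).
    have q0 k : 0 <= 4^-1 ^+ k :> R by rewrite exprn_ge0// invr_ge0.
    move=> /le_trans; apply; rewrite ler_piMr ?gerBl//.
  elim: m => [|m ih].
    rewrite addn0 expr0 subrr mulr0; under eq_fun do rewrite subrr.
    by rewrite nrm0.
  have -> : (fun x => u (j.+1 + m.+1)%N x - u j.+1 x) =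
      (fun x => (u (j.+1 + m).+1 x - u (j.+1 + m)%N x) + (u (j.+1 + m)%N x - u j.+1 x)).
    by apply/funext => x; rewrite addnS subrKA.
  apply: le_trans (L2_add mU _ _).2 _; try exact/(H_L2 H_rks)/(H_sub H_rks).
  apply: le_trans (lerD (u_step _) ih) _.
  rewrite exprD !exprS; set a := _ ^+ j; set b := _ ^+ m.
  by rewrite le_eqVlt; apply/orP; left; apply/eqP; field.
have [B gB] := pb g Hg.
(* The seminorm of [g] is at least (3/4 - 1/3) 4^-j S, hence at least 5/12 (j + 1), which exceeds
   [B] for this j. *)
pose j := Num.truncn (B * (12 / 5)).
have [/= Hyj yj1 [S [S4 Sp SB]]] := nyP j.
have hj : B * (12 / 5) < j.+1%:R by exact: truncnS_gt.
have q0 : 0 < 4^-1 ^+ j :> R by rewrite exprn_gt0// invr_gt0.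
have q4 : 4^-1 ^+ j * 4 ^+ j = 1 :> R by rewrite -exprMn mulVf ?expr1n// pnatr_eq0.
have py : 4^-1 ^+ j * (S * (3 / 4)) <= p (ny j).1 (y j).
  have := pZ (ny j).1 (4 ^+ j)%:C _ (Hy j); rewrite normcR ger0_norm ?exprn_ge0//.
  have -> : (fun x => (4 ^+ j)%:C * y j x) = (ny j).2.
    by apply/funext => x; rewrite /y mulrA -rmorphM [4 ^+ j * _]mulrC q4 mul1r.
  move=> h; rewrite exprVn ler_pdivrMl ?exprn_gt0//.
  exact: le_trans Sp h.
have pg : p (ny j).1 (u j.+1) <= p (ny j).1 g + S * (4^-1 ^+ j / 3).
  have e : u j.+1 = fun x => g x + (-1) * (g x - u j.+1 x).
    by apply/funext => x; ring.
  rewrite [in leLHS]e.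
  apply: le_trans (pD _ _ _ Hg (H_scale H_rks _ (H_sub H_rks Hg (Hu _)))) _.
  rewrite lerD2l (le_trans (pZ _ _ _ (H_sub H_rks Hg (Hu _))))//.
  rewrite normcN Normc.normc1 mul1r (le_trans (SB _ (H_sub H_rks Hg (Hu _))))//.
  have S0 : 0 <= S by rewrite (le_trans _ S4)// mulr_ge0// exprn_ge0.
  by rewrite ler_wpM2l.
have := gB (ny j).1; have := p_step j.
have : j.+1%:R <= 4^-1 ^+ j * S.
  by rewrite exprVn ler_pdivlMl ?exprn_gt0// mulrC.
move: pg py hj; move: (4^-1 ^+ j) (j.+1%:R : R) => a b; nra.
Qed.

End Sokal.

(** * Neumann series *)

Section Resolvent.
Context {R : realType} (mu : {measure set R -> \bar R}) (U : set R).
Hypothesis mU : measurable U.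
Context (H : set (R -> R[i])).
Hypothesis H_rks : reproducing_kernel_subspace mu U H.
Implicit Types f g h psi : R -> R[i].
Implicit Types z c : R[i].
Local Notation L2 := (square_integrable mu U).
Local Notation nrm := (nrm mu).

(* [h = (f - c psi) / (x - z)]; for [psi = 1] the number [c] plays the role of
   the value at [z] of the extension of [f]. *)
Definition res psi z f c h := H h /\ forall x, U x -> h x * (x%:C - z) = f x - c * psi x.

(** The bound concerns every solution, not a chosen one, so at f = 0 it contains uniqueness of c and
    h. *)
Definition bres psi z M := [/\ 0 <= M,
  (forall f, H f -> exists c h, res psi z f c h) &
  (forall f c h, H f -> res psi z f c h -> nrm h <= M * nrm f /\ normc c <= M * nrm f)].

Lemma res_lin psi z a f1 c1 h1 f2 c2 h2 : res psi z f1 c1 h1 -> res psi z f2 c2 h2 ->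
  res psi z (fun x => a * f1 x + f2 x) (a * c1 + c2) (fun x => a * h1 x + h2 x).
Proof.
move=> [H1 e1] [H2 e2]; split; first exact: (rks_lin H_rks).
move=> x Ux; rewrite mulrDl -mulrA e1// e2//; ring.
Qed.

(** Since x - z1 = (x - z) + (z - z1), the problem at z becomes a fixed point equation for h at
    z1. *)
Lemma res_shift psi z1 z f c h : res psi z f c h <->
  res psi z1 (fun x => f x + (z - z1) * h x) c h.
Proof.
split=> -[Hh e]; split => // x /e eh.
  rewrite (_ : _ - z1 = (x%:C - z) + (z - z1)); last by ring.
  by rewrite mulrDr eh; ring.
rewrite (_ : _ - z = (x%:C - z1) - (z - z1)); last by ring.
by rewrite mulrBr eh; ring.
Qed.

Lemma res_uniq psi z M f c1 h1 c2 h2 : bres psi z M ->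
  res psi z f c1 h1 -> res psi z f c2 h2 -> c1 = c2 /\ h1 = h2.
Proof.
move=> [M0 _ hM] r1 r2; have := res_lin (-1) r1 r2.
have -> : (fun x => -1 * f x + f x) = fun=> 0.
  by apply/funext => x; rewrite mulN1r addNr.
move=> r; have [] := hM _ _ _ (rks_zero H_rks) r; rewrite nrm0 mulr0 => h0 c0; split.
  have : ~~ (0 < normc (-1 * c1 + c2)) by rewrite -leNgt.
  by rewrite normc_gt0 negbK mulN1r addrC subr_eq0 => /eqP.
apply/funext => x; have := nrm_eq0 H_rks r.1 h0 x.
by rewrite mulN1r addrC => /subr0_eq.
Qed.

(** The map sending h to the solution at z1 with datum f + (z - z1) h contracts by 1/2, and [u]
    iterates it from 0. For any solution, |h| <= M |f| + |h| / 2 in norm, whence the constant 2M. *)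
Lemma bres_near psi z1 M z : bres psi z1 M -> normc (z - z1) * M <= 2^-1 ->
  bres psi z (2 * M).
Proof.
move=> B zM; have [M0 ex hM] := B; split; first by rewrite mulr_ge0.
- move=> f Hf.
  have exS g : exists ch : R[i] * (R -> R[i]), H g -> res psi z1 g ch.1 ch.2.
    have [Hg|?] := pselect (H g); last by exists (0, fun=> 0).
    by have [c [h ?]] := ex g Hg; exists (c, h).
  have [S SP] := choice exS.
  pose t := z - z1.
  pose u := fix u n := if n is n'.+1 then (S (fun x => t * u n' x + f x)).2 else fun=> 0.
  have Hu n : H (u n).
    elim: n => [|n ih]; first exact: (rks_zero H_rks).
    by have [] := SP _ (rks_lin H_rks t ih Hf).
  pose a n := (S (fun x => t * u n x + f x)).1.
  have uS n : res psi z1 (fun x => t * u n x + f x) (a n) (u n.+1).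
    exact: SP _ (rks_lin H_rks t (Hu n) Hf).
  have u_step n : nrm (fun x => u n.+1 x - u n x) <= M * nrm f * 2^-1 ^+ n.
    elim: n => [|n ih].
      rewrite expr0 mulr1 (_ : (fun x => _) = u 1%N); last first.
        by apply/funext => x; rewrite subr0.
      have [+ _] := hM _ _ _ (rks_lin H_rks t (Hu 0) Hf) (uS 0).
      rewrite (_ : (fun x => _ + f x) = f)//.
      by apply/funext => x; rewrite /= mulr0 add0r.
    have := res_lin (-1) (uS n) (uS n.+1).
    rewrite (_ : (fun x => -1 * (t * _ + _) + _) = fun x => t * (u n.+1 x - u n x)); last first.
      by apply/funext => x; ring.
    rewrite (_ : (fun x => -1 * _ + _) = fun x => u n.+2 x - u n.+1 x); last first.
      by apply/funext => x; rewrite mulN1r addrC.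
    have Hd := H_sub H_rks (Hu n.+1) (Hu n).
    move=> /(hM _ _ _ (H_scale H_rks t Hd))[+ _] => /le_trans; apply.
    apply: (@le_trans _ _ (M * (normc t * nrm (fun x => u n.+1 x - u n x)))).
      by rewrite ler_wpM2l//; exact: nrmZ (H_L2 H_rks Hd).
    rewrite mulrA (mulrC M) exprS mulrCA; apply: ler_pM => //.
    by rewrite mulr_ge0// normc_ge0.
    exact: nrm_ge0.
  have [h Hh hu] := H_complete mU H_rks Hu u_step.
  have Htf := rks_lin H_rks t Hh Hf.
  exists (S (fun x => t * h x + f x)).1, h.
  apply/(res_shift psi z1); have := SP _ Htf.
  rewrite (_ : (fun x => t * h x + f x) = fun x => f x + t * h x); last first.
    by apply/funext => x; rewrite addrC.
  move: Htf.
  rewrite (_ : (fun x => t * h x + f x) = fun x => f x + t * h x); last first.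
    by apply/funext => x; rewrite addrC.
  set F := (fun x => f x + t * h x) => HF SF.
  suff <- : (S F).2 = h by [].
  apply/funext => x; apply/subr0_eq; move: x.
  apply: (nrm_eq0 H_rks (f := fun x => (S F).2 x - h x)).
    by apply: (H_sub H_rks) => //; case: SF.
  (* With A = M times the norm of f, [u n.+1] is within A 2^-n both of [h] and of [(S F).2], so the
     two coincide. *)
  apply/ler_addgt0Pr => e e0; rewrite add0r.
  have := cvg_half (4 * (M * nrm f)).
  move=> /cvgrPdist_lt/(_ e e0)[n _ /(_ n (leqnn n))].
  rewrite sub0r normrN => /ltW/(le_trans (ler_norm _)); apply: le_trans.
  have := res_lin (-1) (uS n) SF.
  rewrite (_ : (fun x => -1 * (t * _ + _) + _) = fun x => t * (h x - u n x)); last first.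
    by apply/funext => x; rewrite /F; ring.
  rewrite (_ : (fun x => -1 * _ + _) = fun x => (S F).2 x - u n.+1 x); last first.
    by apply/funext => x; rewrite mulN1r addrC.
  have Hd := H_sub H_rks Hh (Hu n).
  move=> r; have [+ _] := hM _ _ _ (H_scale H_rks t Hd) r => rn.
  have rn' := le_trans rn (ler_wpM2l M0 (nrmZ mU t (H_L2 H_rks Hd))).
  have hun := hu n; have hun1 := hu n.+1.
  have Hd1 := H_sub H_rks (Hu n.+1) Hh.
  rewrite (_ : (fun x => _ - h x) = fun x => ((S F).2 x - u n.+1 x) + (u n.+1 x - h x)); last first.
    by apply/funext => x; rewrite subrKA.
  apply: le_trans (L2_add mU (H_L2 H_rks r.1) (H_L2 H_rks Hd1)).2 _.
  rewrite (nrmBC mU (H_L2 H_rks (Hu _)) (H_L2 H_rks Hh)).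
  apply: le_trans (lerD rn' hun1) _.
  have n0 := nrm_ge0 mu (fun x => h x - u n x).
  have : M * (normc t * nrm (fun x => h x - u n x)) <= 2^-1 * (2 * (M * nrm f) * 2^-1 ^+ n).
    rewrite [leLHS]mulrA (mulrC M); apply: ler_pM => //.
    by rewrite mulr_ge0// normc_ge0.
  have : 0 <= M * nrm f * 2^-1 ^+ n.
    by rewrite !mulr_ge0 ?nrm_ge0// exprn_ge0// invr_ge0.
  rewrite exprS; move: (M * nrm f) (2^-1 ^+ n) (M * _) => A' b' c'; lra.
move=> f c h Hf r.
have r1 := (res_shift psi z1 z f c h).1 r.
have Hh := r.1.
have HF := H_add H_rks Hf (H_scale H_rks (z - z1) Hh).
have FB : nrm (fun x => f x + (z - z1) * h x) <= nrm f + normc (z - z1) * nrm h.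
  apply: le_trans (L2_add mU (H_L2 H_rks Hf) (H_L2 H_rks (H_scale H_rks _ Hh))).2 _.
  by rewrite lerD2l; exact: nrmZ (H_L2 H_rks Hh).
have [h1 c1] := hM _ _ _ HF r1.
have FB' := ler_wpM2l M0 FB.
have nh := nrm_ge0 mu h; have nf := nrm_ge0 mu f.
have e : M * (normc (z - z1) * nrm h) <= 2^-1 * nrm h.
  by rewrite mulrA (mulrC M) ler_wpM2r.
have hB : nrm h <= 2 * M * nrm f by lra.
split => //.
have : 2^-1 * nrm h <= M * nrm f by lra.
lra.
Qed.

(** h0 + (z - z0) h' solves the problem at z, so uniqueness gives its constant. When c0 = 0 this
    divides c by z - z0, which is how zeros of numerators are cancelled at a pole. *)
Lemma res_taylor psi z0 z M f c h c0 h0 c' h' : bres psi z M ->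
  res psi z f c h -> res psi z0 f c0 h0 -> res psi z h0 c' h' ->
  c = c0 + (z - z0) * c'.
Proof.
move=> B r r0 r'; suff r2 : res psi z f (c0 + (z - z0) * c') (fun x => h0 x + (z - z0) * h' x).
  exact: (res_uniq B r r2).1.
split; first by apply: (H_add H_rks) => //; [case: r0|apply: (H_scale H_rks); case: r'].
move=> x Ux; have e0 := r0.2 x Ux; have e' := r'.2 x Ux.
rewrite (_ : (_ + _) * _ = h0 x * (x%:C - z0) - (z - z0) * h0 x +
  (z - z0) * (h' x * (x%:C - z))); last by ring.
by rewrite e0 e'; ring.
Qed.

Lemma derivable_quadratic (c : Cplane R -> Cplane R) (z0 c1 : Cplane R) (K : R) :
  (\forall z \near z0, normc (c z - c z0 - (z - z0) * c1) <= K * normc (z - z0) ^+ 2) ->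
  derivable c z0 1.
Proof.
move=> /nbhs_normcP[r r0 cK]; apply/cvg_ex; exists c1.
apply/cvgrPdist_lt => e e0.
have e_re := gt0_ReE e0.
have Re0 : 0 < Re e by rewrite -ltcR -e_re.
have K10 : 0 < `|K| + 1 by rewrite ltr_wpDl.
near=> h.
have h0 : h != 0 by near: h; exact: nbhs_dnbhs_neq.
have nh0 : 0 < normc h by rewrite normc_gt0.
have hz : h *: (1 : Cplane R) + z0 - z0 = h by rewrite addrK /GRing.scale/= mulr1.
have hr : normc h < r /\ normc h < Re e / (`|K| + 1).
  near: h; apply: nbhs_dnbhs; apply/nbhs_normcP.
  exists (Num.min r (Re e / (`|K| + 1))).
    by rewrite lt_min r0 divr_gt0.
  by move=> y; rewrite subr0 lt_min => /andP[].
have := cK (h *: (1 : Cplane R) + z0); rewrite hz => /(_ hr.1) le.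
rewrite norm_normc e_re ltcR.
have -> : c1 - h^-1 *: ((c (h *: (1 : Cplane R) + z0)) - c z0) =
    - (h^-1 * (c (h *: (1 : Cplane R) + z0) - c z0 - h * c1)).
  have quotB (a b d : R[i]) : a != 0 -> b - a^-1 * d = - (a^-1 * (d - a * b)).
    by move=> a0; rewrite mulrBr mulKf// opprB.
  exact: quotB.
rewrite normcN Normc.normcM Normc.normcV mulrC ltr_pdivrMr//.
apply: le_lt_trans le _.
rewrite expr2 mulrA ltr_pM2r//.
have [_] := hr; rewrite ltr_pdivlMr// => h1.
apply: le_lt_trans h1; rewrite mulrC ler_pM2l//.
by rewrite (le_trans (ler_norm _))// lerDl.
Unshelve. all: by end_near. Qed.

(** The derivative is the constant [c1] attached to [h0] at z0. With t = z - z0: the norm of h is at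
    most 2M |f|, that of h - h0 at most M |t| |h|, and the remainder at most M |t| |h - h0|, hence
    the quadratic constant. *)
Lemma res_derivable psi z0 M f (c : Cplane R -> Cplane R) : bres psi z0 M -> H f ->
  (\forall z \near (z0 : Cplane R), exists h, res psi z f (c z) h) -> derivable c z0 1.
Proof.
move=> B Hf /nbhs_normcP[r r0 cres]; have [M0 ex hM] := B.
have [|h0 rz0] := cres z0; first by rewrite subrr Normc.normc0.
have [c1 [h1 r1]] := ex _ rz0.1.
apply: (@derivable_quadratic c z0 c1 (M * (M * (2 * M * nrm f)))).
have M10 : 0 < M + 1 by rewrite ltr_wpDl.
apply/nbhs_normcP; exists (Num.min r (2^-1 / (M + 1))).
  by rewrite lt_min r0 divr_gt0// invr_gt0.
move=> z; rewrite lt_min => /andP[zr zM].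
have [h rz] := cres z zr.
have zM' : normc (z - z0) * M <= 2^-1.
  move: zM; rewrite ltr_pdivlMr// => /ltW; apply: le_trans.
  by rewrite ler_wpM2l ?normc_ge0// lerDl.
have Bz := bres_near B zM'; have [_ _ hMz] := Bz.
have [hB _] := hMz _ _ _ Hf rz.
have rz' := (res_shift psi z0 z f (c z) h).1 rz.
have Hh := rz.1.
pose t := z - z0.
have rd := res_lin (-1) rz0 rz'.
rewrite (_ : (fun x => -1 * f x + _) = fun x => t * h x) in rd; last first.
  by apply/funext => x; rewrite /t; ring.
rewrite (_ : (fun x => -1 * h0 x + _) = fun x => h x - h0 x) in rd; last first.
  by apply/funext => x; rewrite mulN1r addrC.
have [dB _] := hM _ _ _ (H_scale H_rks t Hh) rd.
have dB' := le_trans dB (ler_wpM2l M0 (nrmZ mU t (H_L2 H_rks Hh))).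
have re := res_lin (- t) r1 rd.
rewrite (_ : (fun x => - t * h0 x + _) = fun x => t * (h x - h0 x)) in re; last first.
  by apply/funext => x; ring.
have Hd := H_sub H_rks Hh rz0.1.
have [_ cB] := hM _ _ _ (H_scale H_rks t Hd) re.
have cB' := le_trans cB (ler_wpM2l M0 (nrmZ mU t (H_L2 H_rks Hd))).
rewrite (_ : _ - _ = - t * c1 + (-1 * c z0 + c z)); last by rewrite /t; ring.
apply: le_trans cB' _.
have t0 := normc_ge0 t.
rewrite -/t [leRHS](_ : _ = M * (normc t * (M * (normc t * (2 * M * nrm f))))); last by ring.
rewrite ler_wpM2l// ler_wpM2l// (le_trans dB')// ler_wpM2l// ler_wpM2l//.
Qed.

End Resolvent.

(** * Points of U *)

Section RealPoints.
Context {R : realType} (mu : {measure set R -> \bar R}) (U : set R).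
Hypothesis mU : measurable U.
Context (H : set (R -> R[i])).
Hypothesis H_rks : reproducing_kernel_subspace mu U H.
Implicit Types f g h psi : R -> R[i].
Implicit Types z c : R[i].
Local Notation L2 := (square_integrable mu U).
Local Notation nrm := (nrm mu).
Local Notation res := (res U H).
Local Notation bres := (bres mu U H).

Lemma borel_resolvent z : borel_fun U (fun x => (x%:C - z)^-1).
Proof.
case: z => a b; apply/(borel_funP mU).
pose D x : R := (x - a) ^+ 2 + b ^+ 2.
have mD : measurable_fun U (fun x => (D x)^-1).
  rewrite (_ : (fun x => _) = (powR (R := R) ^~ (-1)) \o D); last first.
    by apply/funext => x; rewrite /= powR_inv1// addr_ge0// sqr_ge0.
  apply: measurableT_comp; first exact: measurable_powR.
  apply: measurable_funD => //; apply: measurable_funX.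
  exact: measurable_funB.
split.
  rewrite (_ : _ \o _ = fun x => (x - a) * (D x)^-1).
    by apply: measurable_funM => //; exact: measurable_funB.
  by apply/funext => x; rewrite /D /= sub0r sqrrN.
rewrite (_ : _ \o _ = fun x => b * (D x)^-1); first exact: measurable_funM.
by apply/funext => x; rewrite /D /= sub0r sqrrN mulNr opprK.
Qed.

Lemma L2_resolvent z d f : 0 < d -> (forall x, U x -> d <= normc (x%:C - z)) -> L2 f ->
  L2 (fun x => (x%:C - z)^-1 * f x) /\
  nrm (fun x => (x%:C - z)^-1 * f x) <= d^-1 * nrm f.
Proof.
move=> d0 hd; apply: L2_mul => //; first by rewrite invr_ge0 ltW.
  exact: borel_resolvent.
move=> x Ux; rewrite Normc.normcV lef_pV2 ?posrE ?hd//.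
exact: lt_le_trans (hd _ Ux).
Qed.

(* Closed graph: on [far k n] the division by [x - k] is a bounded operator,
   so uniform boundedness over [n] bounds f |-> (f - f k) / (x - k). *)
Lemma bres_real k : mu [set k] = 0%E -> U k ->
  (forall f, H f -> quotient_in U H (fun x => f x - f k) k%:C) ->
  exists M, bres (fun=> 1) k%:C M.
Proof.
move=> muk Uk Hdiv.
(* At x = k the left side vanishes, which forces c. *)
have resk f c h : res (fun=> 1) k%:C f c h -> c = f k.
  move=> [_ /(_ k Uk)]; rewrite subrr mulr0 mulr1 => /esym/eqP.
  by rewrite subr_eq0 => /eqP.
(* Here [h] vanishes off k, a null set, so its norm is 0, and then it vanishes at k as well. *)
have uniq0 h : H h -> (forall x, U x -> h x * (x%:C - k%:C) = 0) -> forall x, h x = 0.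
  move=> Hh h0; apply: (nrm_eq0 H_rks) => //.
  rewrite (nrm_ae mU (g := fun=> 0)) ?nrm0//; first exact: (H_L2 H_rks).
    exact: (H_L2 H_rks (rks_zero H_rks)).
  exists [set k]; split => //.
  move=> x /= nx; apply: contrapT => /eqP xk; apply: nx => Ux.
  have /eqP := h0 x Ux; rewrite mulf_eq0 => /orP[/eqP//|].
  by rewrite -rmorphB/= eq_complex/= subr_eq0 (negbTE xk).
have uniq f c1 h1 c2 h2 : res (fun=> 1) k%:C f c1 h1 -> res (fun=> 1) k%:C f c2 h2 ->
    h1 = h2.
  move=> r1 r2; apply/funext => x; apply/subr0_eq; move: x.
  apply: uniq0 => [|x Ux]; first by apply: (H_sub H_rks); [case: r1|case: r2].
  by rewrite mulrBl r1.2// r2.2// (resk _ _ _ r1) (resk _ _ _ r2) subrr.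
have exT f : exists h, H f -> res (fun=> 1) k%:C f (f k) h.
  have [Hf|?] := pselect (H f); last by exists (fun=> 0).
  have [h Hh e] := Hdiv f Hf; exists h => _; split => // x Ux.
  by rewrite mulr1 e.
have [T TP] := choice exT.
have HT f : H f -> H (T f) by move=> /TP[].
have Tlin a f g : H f -> H g -> T (fun x => a * f x + g x) = fun x => a * T f x + T g x.
  move=> Hf Hg; apply: uniq (TP _ (rks_lin H_rks a Hf Hg)) _.
  exact: (res_lin H_rks a (TP _ Hf) (TP _ Hg)).
have TD f g : H f -> H g -> T (fun x => f x + g x) = fun x => T f x + T g x.
  move=> Hf Hg; have := Tlin 1 f g Hf Hg.
  rewrite (_ : (fun x => 1 * f x + _) = fun x => f x + g x); last first.
    by apply/funext => x; rewrite mul1r.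
  by move=> ->; apply/funext => x; rewrite mul1r.
have T0 : T (fun=> 0) = fun=> 0.
  have r0 : res (fun=> 1) k%:C (fun=> 0) 0 (fun=> 0).
    by split=> [|x _]; [exact: (rks_zero H_rks)|rewrite !mul0r subrr].
  exact: uniq (TP _ (rks_zero H_rks)) r0.
have TZ a f : H f -> T (fun x => a * f x) = fun x => a * T f x.
  move=> Hf; have := Tlin a f (fun=> 0) Hf (rks_zero H_rks).
  rewrite T0 (_ : (fun x => a * f x + _) = fun x => a * f x); last first.
    by apply/funext => x; rewrite addr0.
  by move=> ->; apply/funext => x; rewrite addr0.
pose p n f := nrm (fun x => far k n x * T f x).
have Lfar n f : H f -> L2 (fun x => far k n x * T f x).
  by move=> /HT/(H_L2 H_rks)/(nrm_far mU k n)[].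
have pD n f g : H f -> H g -> p n (fun x => f x + g x) <= p n f + p n g.
  move=> Hf Hg; apply: le_trans (L2_add mU (Lfar n f Hf) (Lfar n g Hg)).2.
  rewrite /p TD// (_ : (fun x => _) = fun x => far k n x * T f x + far k n x * T g x)//.
  by apply/funext => x; rewrite mulrDr.
have pZ n a f : H f -> p n (fun x => a * f x) <= normc a * p n f.
  move=> Hf; apply: le_trans (nrmZ mU a (Lfar n f Hf)).
  rewrite /p TZ// (_ : (fun x => _) = fun x => a * (far k n x * T f x))//.
  by apply/funext => x; rewrite mulrCA.
(* If f(k) = 0, the truncated quotient is f times a multiplier of modulus at most n + 1. *)
have p0 n f : H f -> f k = 0 -> p n f <= n.+1%:R * nrm f.
  move=> Hf fk0; pose m x := far k n x * (x%:C - k%:C)^-1.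
  have [||||_] := @L2_mul _ mu U mU m f n.+1%:R => //.
  - by apply: borel_mul => //; [exact: borel_far|exact: borel_resolvent].
  - move=> x Ux; rewrite /m farE Normc.normcM Normc.normcV -rmorphB normcR.
    have [nx|_] := boolP (_ <= `|x - k|); last by rewrite Normc.normc0 mul0r.
    rewrite Normc.normc1 mul1r -[leRHS]invrK lef_pV2 ?posrE ?invr_gt0//.
    by apply: lt_le_trans nx; rewrite invr_gt0.
  - exact: (H_L2 H_rks).
  apply: le_trans; rewrite /p le_eqVlt; apply/orP; left; apply/eqP; congr nrm.
  apply/funext => x; rewrite /m -mulrA.
  have [Ux|Ux] := pselect (U x); last first.
    by rewrite (H_off H_rks (HT _ Hf))// (H_off H_rks Hf)// !mulr0.
  rewrite farE; have [nx|_] := boolP (_ <= `|x - k|); last by rewrite !mul0r.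
  congr (_ * _); have := (TP _ Hf).2 x Ux; rewrite fk0 mul0r subr0 => <-.
  rewrite mulrC mulfK// -rmorphB/= eq_complex/= eqxx andbT.
  by rewrite -normr_gt0 (lt_le_trans _ nx)// invr_gt0.
have [C C0 hC] := H_eval H_rks Uk.
(* Constants need not lie in [H]; f(k) is removed by an element with value 1 at k, or by 0 when all
   of [H] vanishes at k. *)
have [f0 Hf0 f0P] : exists2 f0, H f0 & forall f, H f -> f k - f k * f0 k = 0.
  have [[f1 [Hf1 f1k]]|no] := pselect (exists f1, H f1 /\ f1 k <> 0).
    exists (fun x => (f1 k)^-1 * f1 x); first exact: (H_scale H_rks).
    by move=> f Hf; rewrite mulVf ?mulr1 ?subrr//; apply/eqP.
  exists (fun=> 0); first exact: (rks_zero H_rks).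
  move=> f Hf; rewrite mulr0 subr0; apply: contrapT => fk.
  by apply: no; exists f.
have pB n : exists B, forall f, H f -> p n f <= B * nrm f.
  exists (n.+1%:R * (1 + C * nrm f0) + C * p n f0) => f Hf.
  have Hg := H_sub H_rks Hf (H_scale H_rks (f k) Hf0).
  have gB := p0 n _ Hg (f0P f Hf).
  have := pD n _ _ Hg (H_scale H_rks (f k) Hf0).
  rewrite (_ : (fun x => _ - _ + _) = f); last by apply/funext => x; rewrite subrK.
  move=> /le_trans; apply; apply: le_trans (lerD gB (pZ n (f k) f0 Hf0)) _.
  rewrite mulrDl -mulrA; apply: lerD.
    rewrite ler_wpM2l// mulrDl mul1r.
    apply: le_trans (nrmB mU (H_L2 H_rks Hf) (H_L2 H_rks (H_scale H_rks (f k) Hf0))).2 _.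
    rewrite lerD2l (le_trans (nrmZ mU (f k) (H_L2 H_rks Hf0)))//.
    by rewrite mulrAC ler_wpM2r ?nrm_ge0// hC.
  by rewrite mulrAC ler_wpM2r ?nrm_ge0// hC.
(* Truncation does not increase the norm, so [T f] itself bounds all its truncations. *)
have pb f : H f -> exists B, forall n, p n f <= B.
  move=> Hf; exists (nrm (T f)) => n.
  exact: (nrm_far mU k n (H_L2 H_rks (HT f Hf))).2.
have [B B0 hB] := uniform_boundedness mU H_rks pD pZ pB pb.
exists (B + C); split; first by rewrite addr_ge0.
  by move=> f Hf; exists (f k), (T f); exact: TP.
move=> f c h Hf r; rewrite (resk _ _ _ r) (uniq _ _ _ _ _ r (TP _ Hf)); split.
  apply: (@le_trans _ _ (B * nrm f)); last by rewrite ler_wpM2r ?nrm_ge0// lerDl.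
  apply: (nrm_far_le mU muk) => //; first by rewrite mulr_ge0// nrm_ge0.
    exact: (H_L2 H_rks (HT f Hf)).
  by move=> n; exact: hB.
by apply: le_trans (hC _ Hf) _; rewrite ler_wpM2r ?nrm_ge0// lerDr.
Qed.

End RealPoints.

(** * Points off the closure of U *)

Section Local.
Context {R : realType} (mu : {measure set R -> \bar R}) (U : set R).
Hypothesis mU : measurable U.
Context (H : set (R -> R[i])).
Hypothesis H_rks : reproducing_kernel_subspace mu U H.
Implicit Types f g h psi : R -> R[i].
Implicit Types z c : R[i].
Local Notation L2 := (square_integrable mu U).
Local Notation nrm := (nrm mu).
Local Notation res := (res U H).
Local Notation bres := (bres mu U H).

Definition solvable psi z := forall f, H f -> exists c h, res psi z f c h.

(* [s] connects the problems with right-hand sides [1] and [psi]: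
   if [h = (f - c) / (x - z)], then [h + c s = (f - c (z - z0)^n psi) / (x - z)]. *)
Definition tame z0 n r := exists psi M, (n = 0%N -> psi = fun=> 1) /\
  forall z, normc (z - z0) < r -> bres psi z M /\
    exists2 s, H s & forall x, U x -> s x * (x%:C - z) = 1 - (z - z0) ^+ n * psi x.

Definition phi z x : R[i] := if pselect (U x) then (x%:C - z)^-1 else 0.

Lemma phi_in z x : U x -> phi z x = (x%:C - z)^-1.
Proof. by move=> Ux; rewrite /phi; case: pselect. Qed.

Lemma phi_out z x : ~ U x -> phi z x = 0.
Proof. by move=> Ux; rewrite /phi; case: pselect. Qed.

Section Point.
Variables (z0 : R[i]) (d : R).
Hypothesis d0 : 0 < d.
Hypothesis hd : forall x, U x -> d <= normc (x%:C - z0).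
Hypothesis L2phi : L2 (phi z0).

(** [W 0] is the constant 1 on the whole line, also off [U], so n = 0 gives literally the original
    problem. *)
Let W n x := phi z0 x ^+ n.

Lemma phiE x : U x -> phi z0 x * (x%:C - z0) = 1.
Proof.
move=> Ux; rewrite phi_in// mulVf// -normc_gt0.
exact: lt_le_trans (hd Ux).
Qed.

Lemma L2_W n : L2 (W n.+1) /\ nrm (W n.+1) <= d^-1 ^+ n * nrm (phi z0).
Proof.
elim: n => [|n [ih1 ih2]].
  by rewrite expr0 mul1r (_ : W 1 = phi z0).
have [h1 h2] := L2_resolvent mU d0 hd ih1.
have -> : W n.+2 = fun x => (x%:C - z0)^-1 * W n.+1 x.
  apply/funext => x; rewrite /W exprS; have [Ux|Ux] := pselect (U x).
    by rewrite {1}phi_in.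
  by rewrite phi_out// exprS !mul0r mulr0.
split => //; apply: le_trans h2 _.
by rewrite exprS -mulrA ler_wpM2l// invr_ge0 ltW.
Qed.

Lemma dist_near z x : normc (z - z0) < d / 2 -> U x -> d / 2 <= normc (x%:C - z).
Proof.
move=> zd Ux; have := hd Ux; have := normcD (x%:C - z) (z - z0).
rewrite subrKA => h1 h2; lra.
Qed.

(** Finite geometric expansion of 1 / (x - z) at z0, with its remainder; the sum is the function [s]
    required by [tame]. *)
Lemma sum_W n z x : U x -> (\sum_(j < n) (z - z0) ^+ j * W j.+1 x) * (x%:C - z) =
  1 - (z - z0) ^+ n * W n x.
Proof.
move=> Ux; elim: n => [|n ih].
  by rewrite big_ord0 mul0r !expr0 mulr1 subrr.
rewrite big_ord_recr/= mulrDl ih /W !exprS.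
have := phiE Ux; set p := phi z0 x; move=> e.
rewrite (_ : x%:C - z = (x%:C - z0) - (z - z0)); last by ring.
set t := z - z0; set y := x%:C - z0.
rewrite (_ : _ * _ * _ = t ^+ n * p ^+ n * (p * y) - t ^+ n * p ^+ n * p * t); last by ring.
rewrite e; ring.
Qed.

Lemma H_sum_W n z : (forall j, (j < n)%N -> H (W j.+1)) ->
  H (fun x => \sum_(j < n) (z - z0) ^+ j * W j.+1 x).
Proof.
elim: n => [|n ih] hW.
  rewrite (_ : (fun x => _) = fun=> 0); first exact: (rks_zero H_rks).
  by apply/funext => x; rewrite big_ord0.
rewrite (_ : (fun x => _) = fun x =>
    \sum_(j < n) (z - z0) ^+ j * W j.+1 x + (z - z0) ^+ n * W n.+1 x); last first.
  by apply/funext => x; rewrite big_ord_recr.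
apply: (H_add H_rks).
  by apply: ih => j jn; apply: hW; exact: ltnW.
by apply: (H_scale H_rks); exact: hW.
Qed.

(** The geometric series in phi converges in [H] because |z - z0| / d <= 1/2. Its limit is
    identified at each point of [U] through the bounded evaluation and [sum_W]. *)
Lemma kernel_near z : (forall j, H (W j.+1)) -> normc (z - z0) < d / 2 ->
  quotient_in U H (fun=> 1) z.
Proof.
move=> hW zd; pose u n x := \sum_(j < n) (z - z0) ^+ j * W j.+1 x.
have Hu n : H (u n) by apply: H_sum_W.
have td : normc (z - z0) * d^-1 <= 2^-1.
  by rewrite ler_pdivrMr// mulrC ltW.
have [|g Hg gu] := H_complete mU H_rks Hu (A := nrm (phi z0)).
  move=> n; rewrite (_ : (fun x => _) = fun x => (z - z0) ^+ n * W n.+1 x); last first.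
    by apply/funext => x; rewrite /u big_ord_recr/= [LHS]addrC addKr.
  apply: le_trans (nrmZ mU _ (L2_W n).1) _.
  rewrite normcX; apply: (@le_trans _ _ (normc (z - z0) ^+ n * (d^-1 ^+ n * nrm (phi z0)))).
    by rewrite ler_wpM2l ?exprn_ge0 ?normc_ge0//; exact: (L2_W n).2.
  rewrite mulrA -exprMn mulrC ler_wpM2l ?nrm_ge0// lerXn2r ?nnegrE ?invr_ge0//.
  by rewrite divr_ge0 ?normc_ge0// ltW.
exists g => // x Ux; apply/subr0_eq; apply: contrapT => /eqP ne.
have [C C0 hC] := H_eval H_rks Ux.
(* The first term comes from the tail of the series evaluated at x, the 1 from the remainder in
   [sum_W]. *)
pose K := normc (x%:C - z) * (C * (2 * nrm (phi z0))) + 1.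
have bnd n : normc (g x * (x%:C - z) - 1) <= K * 2^-1 ^+ n.
  have -> : g x * (x%:C - z) - 1 = (g x - u n x) * (x%:C - z) - (z - z0) ^+ n * W n x.
    by rewrite mulrBl sum_W//; ring.
  apply: le_trans (normcD _ _) _; rewrite normcN /K [leRHS]mulrDl mul1r; apply: lerD.
    rewrite Normc.normcM mulrC -mulrA ler_wpM2l ?normc_ge0//.
    apply: le_trans (hC _ (H_sub H_rks Hg (Hu n))) _.
    by rewrite -mulrA ler_wpM2l// gu.
  rewrite Normc.normcM !normcX -exprMn lerXn2r ?nnegrE ?invr_ge0//.
    by rewrite mulr_ge0// normc_ge0.
  apply: le_trans td; rewrite ler_wpM2l ?normc_ge0// phi_in//.
  by rewrite Normc.normcV lef_pV2 ?posrE// ?hd// (lt_le_trans d0 (hd Ux)).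
have := cvg_half K.
have e0 : 0 < normc (g x * (x%:C - z) - 1) by rewrite normc_gt0.
move=> /cvgrPdist_lt/(_ _ e0)[n _ /(_ n (leqnn n))].
rewrite sub0r normrN ltNge => /negP; apply; apply: le_trans (bnd n) (ler_norm _).
Qed.

(* [c v + h = (f - (z - z0) c v) / (x - z)] for [v = phi^(n+1)], so the distance
   from [v] to [H] bounds [c], uniformly for [z] near [z0]. *)
Lemma uniform_bres n : U !=set0 -> ~ H (W n.+1) -> exists r M, 0 < r /\
  forall z, normc (z - z0) < r -> solvable (W n) z -> bres (W n) z M.
Proof.
move=> U0 nH; have [L2v _] := L2_W n.
have [k [Uk [e e0 hk]]] := H_dist_gt0 mU H_rks U0 L2v nH.
have [C C0 hC] := H_eval H_rks Uk.
set v := W n.+1 in nH L2v hk.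
pose Kv := nrm v + normc (v k).
have Kv0 : 0 <= Kv by rewrite addr_ge0 ?nrm_ge0 ?normc_ge0.
have d20 : 0 < d / 2 by rewrite divr_gt0.
have dV0 : 0 <= (d / 2)^-1 by rewrite invr_ge0 ltW.
(* Distance gives e |c| <= (d/2)^-1 ((1 + C) |f| + |t| |c| Kv); half of the left side absorbs the
   last term. *)
pose M1 := 2 / e * ((d / 2)^-1 * (1 + C)).
have M10 : 0 <= M1.
  by rewrite mulr_ge0 ?divr_ge0 ?(ltW e0)// mulr_ge0// addr_ge0.
(* The second entry makes |t| (d/2)^-1 Kv at most e / 2, as the absorption requires. *)
pose r := Num.min (d / 2) (e / 2 / ((d / 2)^-1 * Kv + 1)).
have q0 : 0 < (d / 2)^-1 * Kv + 1 by rewrite ltr_wpDl ?mulr_ge0.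
have r0 : 0 < r by rewrite lt_min d20 !divr_gt0.
exists r, ((d / 2)^-1 + 2 * M1 * nrm v + M1); split => // z.
rewrite lt_min => /andP[zd ze] sol; split => //.
  by rewrite addr_ge0// addr_ge0// mulr_ge0 ?nrm_ge0// mulr_ge0.
move=> f c h Hf [Hh hE].
pose t := z - z0; pose w x := f x - t * c * v x.
have t0 := normc_ge0 t.
have L2f := H_L2 H_rks Hf; have L2h := H_L2 H_rks Hh.
have key x : (x%:C - z)^-1 * w x = c * v x + h x.
  have [Ux|Ux] := pselect (U x); last first.
    rewrite /w (H_off H_rks Hf)// (H_off H_rks Hh)//.
    by rewrite (_ : v x = 0) ?mulr0 ?subr0 ?addr0 ?mulr0//; case: L2v => ->.
  have xz : x%:C - z != 0.
    by rewrite -normc_gt0 (lt_le_trans d20)// dist_near.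
  apply: (mulIf xz); rewrite mulrAC mulVf// mul1r mulrDl hE// /w /v /W exprS.
  have := phiE Ux; set y := phi z0 x => ey.
  rewrite (_ : x%:C - z = (x%:C - z0) - t); last by rewrite /t; ring.
  rewrite (_ : c * (y * y ^+ n) * _ =
    c * y ^+ n * (y * (x%:C - z0)) - t * c * (y * y ^+ n)); last by ring.
  by rewrite ey; ring.
have L2cv := L2_mul mU (normc_ge0 c) (borel_cst mU c) (fun x _ => lexx _) L2v.
have L2tv := L2_mul mU (normc_ge0 (t * c)) (borel_cst mU (t * c)) (fun x _ => lexx _) L2v.
have [L2w wB] := nrmB mU L2f L2tv.1.
have [_ rB] := L2_resolvent mU d20 (fun x => @dist_near z x zd) L2w.
have eK : (fun x => (x%:C - z)^-1 * w x) = fun x => c * v x + h x.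
  by apply/funext => x; rewrite key.
rewrite eK in rB.
have wN : nrm w <= nrm f + normc t * normc c * nrm v.
  apply: le_trans wB _; rewrite lerD2l -Normc.normcM; exact: L2tv.2.
have cvh : nrm (fun x => c * v x + h x) <=
    (d / 2)^-1 * (nrm f + normc t * normc c * nrm v).
  by apply: le_trans rB _; rewrite ler_wpM2l.
have cvk : normc (c * v k + h k) <=
    (d / 2)^-1 * (C * nrm f + normc t * normc c * normc (v k)).
  rewrite -key Normc.normcM Normc.normcV; apply: ler_pM; rewrite ?invr_ge0 ?normc_ge0//.
    by rewrite lef_pV2 ?posrE// ?(lt_le_trans d20) ?dist_near.
  apply: le_trans (normcD _ _) _; rewrite normcN !Normc.normcM lerD2r; exact: hC.
(* The distance estimate is applied to - h / c in [H] and multiplied by |c|. *)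
have dist : normc c * e <= nrm (fun x => c * v x + h x) + normc (c * v k + h k).
  have [->|c0] := eqVneq c 0.
    by rewrite Normc.normc0 mul0r addr_ge0 ?nrm_ge0 ?normc_ge0.
  have := hk _ (H_scale H_rks (- c^-1) Hh).
  have nc0 : 0 < normc c by rewrite normc_gt0.
  have -> : (fun x => v x - - c^-1 * h x) = fun x => c^-1 * (c * v x + h x).
    by apply/funext => x; rewrite mulrDr mulKf// mulNr opprK.
  have -> : v k - - c^-1 * h k = c^-1 * (c * v k + h k).
    by rewrite mulrDr mulKf// mulNr opprK.
  have L2s : L2 (fun x => c * v x + h x) by exact: (L2_add mU L2cv.1 L2h).1.
  have := nrmZ mU c^-1 L2s; rewrite Normc.normcM Normc.normcV => h1 h2.
  rewrite mulrC -ler_pdivlMr// mulrC mulrDr; apply: le_trans h2 _.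
  by rewrite lerD2r.
have nf := nrm_ge0 mu f; have nv := nrm_ge0 mu v; have nc := normc_ge0 c.
have tK : normc t * ((d / 2)^-1 * Kv) <= e / 2.
  have : normc t * ((d / 2)^-1 * Kv + 1) <= e / 2 by rewrite -ler_pdivlMr// ltW.
  by apply: le_trans; rewrite ler_wpM2l// lerDl.
have cB : normc c <= M1 * nrm f.
  have := ler_wpM2l nc tK => tK'.
  have h3 : normc c * (e / 2) <= (d / 2)^-1 * (1 + C) * nrm f.
    move: dist cvh cvk tK'; rewrite /Kv; nra.
  rewrite /M1 -mulrA (_ : 2 / e = (e / 2)^-1); last by rewrite invf_div.
  by rewrite ler_pdivlMl ?divr_gt0// [leLHS]mulrC.
have td1 : normc t * (d / 2)^-1 <= 1 by rewrite ler_pdivrMr// mul1r ltW.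
have hB : nrm h <= ((d / 2)^-1 + 2 * M1 * nrm v) * nrm f.
  have -> : h = fun x => (c * v x + h x) - c * v x.
    by apply/funext => x; rewrite addrC addKr.
  have L2s : L2 (fun x => c * v x + h x) by exact: (L2_add mU L2cv.1 L2h).1.
  apply: le_trans (nrmB mU L2s L2cv.1).2 _.
  apply: le_trans (lerD cvh L2cv.2) _.
  have h4 := ler_wpM2l (mulr_ge0 nc nv) td1.
  have h5 := ler_wpM2r nv cB.
  nra.
have h6 : 0 <= M1 * nrm f by rewrite mulr_ge0.
have h7 : 0 <= (d / 2)^-1 * nrm f by rewrite mulr_ge0.
have h8 : 0 <= M1 * nrm v * nrm f by rewrite mulr_ge0// mulr_ge0.
by split; nra.
Qed.

(** With n the least index such that [W n.+1] is outside [H], all lower powers are available for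
    [sum_W]; if n > 0, [W 1] is the kernel at z0. *)
Lemma tame_or_kernel : U !=set0 -> exists2 r, 0 < r &
  (forall z, normc (z - z0) < r -> quotient_in U H (fun=> 1) z) \/
  ((exists z, [/\ normc (z - z0) < r, z != z0 & solvable (fun=> 1) z]) ->
   exists2 n, ((0 < n)%N -> quotient_in U H (fun=> 1) z0) & tame z0 n r).
Proof.
move=> U0.
have [hW|noW] := pselect (forall j, H (W j.+1)).
  exists (d / 2); first by rewrite divr_gt0.
  by left => z; exact: kernel_near.
have exW : exists j, ~~ `[< H (W j.+1) >].
  apply: contrapT => no; apply: noW => j; apply: contrapT => nj; apply: no.
  by exists j; apply/asboolPn.
have [n /asboolPn nH hmin] := ex_minnP exW.
have HW j : (j < n)%N -> H (W j.+1).
  move=> jn; apply: contrapT => /asboolPn/hmin; by rewrite leqNgt jn.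
have [r1 [M [r10 hr]]] := uniform_bres U0 nH.
have M0 : 0 < 4 * (`|M| + 1) by rewrite mulr_gt0// ltr_wpDl.
(* Two points of this disc are at most 1 / (2 (|M| + 1)) apart, within the Neumann radius of
   either. *)
exists (Num.min r1 (4 * (`|M| + 1))^-1); first by rewrite lt_min r10 invr_gt0.
right => -[z1 []]; rewrite lt_min => /andP[z1r z1M] z10 sol1.
(* Adding c times the sum of [sum_W] to a solution for 1 turns c into c (z1 - z0)^n times [W n]. *)
have solW : solvable (W n) z1.
  move=> f Hf; have [c [h [Hh hE]]] := sol1 f Hf.
  have z10' : z1 - z0 != 0 by rewrite subr_eq0.
  exists (c * (z1 - z0) ^+ n), (fun x => c * (\sum_(j < n) (z1 - z0) ^+ j * W j.+1 x) + h x).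
  split; first by apply: (rks_lin H_rks) => //; exact: H_sum_W.
  by move=> x Ux; rewrite mulrDl -mulrA sum_W// hE//; ring.
have B1 := hr _ z1r solW.
exists n.
  case: n {nH hmin solW B1 hr} HW => // n HW _.
  exists (W 1); first exact: HW.
  by move=> x Ux; rewrite /W expr1 phiE.
exists (W n), M; split; first by move=> ->; apply/funext => x; rewrite /W expr0.
move=> z; rewrite lt_min => /andP[zr zM]; split; last first.
  exists (fun x => \sum_(j < n) (z - z0) ^+ j * W j.+1 x); first exact: H_sum_W.
  by move=> x Ux; rewrite sum_W.
(* The Neumann step supplies only solvability at z; the bound [M] is restored by [hr]. *)
apply: hr => //; suff /(bres_near mU H_rks B1)[] : normc (z - z1) * M <= 2^-1 by [].
have := normcD (z - z0) (z0 - z1); rewrite subrKA [normc (z0 - _)]normcB => h.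
have zz : normc (z - z1) <= 2 * (4 * (`|M| + 1))^-1 by lra.
have := ler_wpM2r (normr_ge0 M) zz.
have h1 : 2 * (4 * (`|M| + 1))^-1 * `|M| <= 2^-1.
  rewrite mulrAC ler_pdivrMr//; have := normr_ge0 M; lra.
move=> h2; apply: le_trans h1; apply: le_trans h2.
by rewrite ler_wpM2l ?normc_ge0// ler_norm.
Qed.

End Point.

End Local.

(** * Propagation *)

Section Good.
Context {R : realType} (mu : {measure set R -> \bar R}) (U : set R).
Hypothesis mU : measurable U.
Context (H : set (R -> R[i])).
Hypothesis H_rks : reproducing_kernel_subspace mu U H.
Implicit Types f g h psi : R -> R[i].
Implicit Types z c : R[i].
Local Notation L2 := (square_integrable mu U).
Local Notation nrm := (nrm mu).
Local Notation res := (res U H).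
Local Notation bres := (bres mu U H).
Local Notation tame := (tame mu U H).
Local Notation phi := (phi U).
Local Notation kernel_in z := (quotient_in U H (fun=> 1) z).

Definition reg z := exists M, bres (fun=> 1) z M.

(** A positive order is allowed only where the Cauchy kernel is in [H]; this places the poles. *)
Definition good z0 := exists n r,
  [/\ 0 < r, (0 < n)%N -> kernel_in z0 & tame z0 n r].

Lemma res_one psi z f c h s t : t != 0 -> H s ->
  (forall x, U x -> s x * (x%:C - z) = 1 - t * psi x) -> res psi z f c h ->
  res (fun=> 1) z f (c / t) (fun x => (- (c / t)) * s x + h x).
Proof.
move=> t0 Hs hs [Hh hE]; split; first exact: (rks_lin H_rks).
move=> x Ux; have := hs x Ux; have := hE x Ux.
move: (x%:C - z) (f x) (h x) (s x) (psi x) => y fx hx sx px e1 e2.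
have -> : (- (c / t) * sx + hx) * y = - (c / t) * (sx * y) + hx * y by ring.
by rewrite e2 e1; field.
Qed.

(** The kernel solves the problem with f = 0 and c = -1, against the bound on c. *)
Lemma reg_not_kernel z : reg z -> ~ kernel_in z.
Proof.
move=> [M [_ _ hM]] [h Hh hE].
have [|_] := hM _ (-1) h (rks_zero H_rks); first by split => // x /hE ->; ring.
by rewrite nrm0 mulr0 normcN Normc.normc1 ler10.
Qed.

(** With t = (z - z0)^n invertible, (c, h) -> (c t, h + c s) carries solutions for 1 to solutions
    for psi. The resulting bound involves 1 / |t|, so it is not uniform near z0. *)
Lemma tame_reg z0 n r z : tame z0 n r -> normc (z - z0) < r -> (z == z0 -> n = 0%N) ->
  reg z.
Proof.
move=> [psi [M [psi1 hz]]] zr zn; have [[M0 ex hM] [s Hs hs]] := hz z zr.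
have [n0|n0] := eqVneq n 0%N; first by exists M; rewrite -psi1.
have zz0 : z - z0 != 0.
  by rewrite subr_eq0; apply/negP => /zn; apply/eqP.
have t0 : (z - z0) ^+ n != 0 by rewrite expf_neq0.
set t := (z - z0) ^+ n in t0 hs.
have nt0 : 0 < normc t by rewrite normc_gt0.
have ns := nrm_ge0 mu s; have nV : 0 <= (normc t)^-1 by rewrite invr_ge0 ltW.
have M1 : 0 <= (normc t)^-1 * M by rewrite mulr_ge0.
exists (M + (normc t)^-1 * M * nrm s + (normc t)^-1 * M); split.
- by rewrite addr_ge0// addr_ge0// mulr_ge0.
- move=> f Hf; have [c [h r1]] := ex f Hf.
  by exists (c / t); eexists; exact: (res_one t0 Hs hs r1).
move=> f c h Hf [Hh hE].
have r1 : res psi z f (c * t) (fun x => c * s x + h x).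
  split; first exact: (rks_lin H_rks).
  by move=> x Ux; rewrite mulrDl -mulrA hs// hE//; ring.
have [hB cB] := hM _ _ _ Hf r1; have nf := nrm_ge0 mu f.
have cB' : normc c <= (normc t)^-1 * M * nrm f.
  by rewrite -mulrA ler_pdivlMl// mulrC -Normc.normcM.
have L2s := H_L2 H_rks (H_scale H_rks c Hs).
have hB' : nrm h <= M * nrm f + normc c * nrm s.
  rewrite (_ : h = fun x => (c * s x + h x) - c * s x); last first.
    by apply/funext => x; rewrite [RHS]addrC addKr.
  apply: le_trans (nrmB mU (H_L2 H_rks r1.1) L2s).2 _.
  by apply: lerD => //; exact: nrmZ (H_L2 H_rks Hs).
have h1 := ler_wpM2r ns cB'.
have h2 : 0 <= (normc t)^-1 * M * nrm f by rewrite mulr_ge0.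
have h3 : 0 <= (normc t)^-1 * M * nrm s * nrm f by rewrite mulr_ge0// mulr_ge0.
have h4 : 0 <= M * nrm f by rewrite mulr_ge0.
clear -hB' cB' h1 h2 h3 h4; move: (normc t)^-1 hB' cB' h1 h2 h3 h4 => V *; split; nra.
Qed.

Lemma reg_tame z0 : reg z0 -> exists2 r, 0 < r & tame z0 0 r.
Proof.
move=> [M B]; have [M0 _ _] := B.
have M10 : 0 < M + 1 by rewrite ltr_wpDl.
exists (2^-1 / (M + 1)); first by rewrite divr_gt0// invr_gt0.
exists (fun=> 1), (2 * M); split => // z; rewrite ltr_pdivlMr// => /ltW h; split.
  apply: (bres_near mU H_rks B); apply: le_trans h.
  by rewrite ler_wpM2l ?normc_ge0// lerDl.
exists (fun=> 0); first exact: (rks_zero H_rks).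
by move=> x _; rewrite expr0 mul0r mulr1 subrr.
Qed.

Lemma reg_good z0 : reg z0 -> good z0.
Proof. by move=> /reg_tame[r r0 tz]; exists 0%N, r. Qed.

Lemma good_reg_near z0 e : good z0 -> 0 < e ->
  exists z, [/\ z != z0, normc (z - z0) < e & reg z].
Proof.
move=> [n [r [r0 _ tz]]] e0; pose q := Num.min e r / 2.
have m0 : 0 < Num.min e r by rewrite lt_min e0.
have q0 : 0 < q by rewrite divr_gt0.
have qm : q < Num.min e r by rewrite ltr_pdivrMr// ltr_pMr// ltr1n.
have nq : normc (z0 + q%:C - z0) = q by rewrite addrAC subrr add0r normcR gtr0_norm.
have [qe qr] : q < e /\ q < r by move: qm; rewrite lt_min => /andP.
have ne : z0 + q%:C != z0 by rewrite -subr_eq0 -normc_gt0 nq.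
exists (z0 + q%:C); rewrite ne nq; split => //.
by apply: (tame_reg tz); rewrite ?nq// (negbTE ne).
Qed.

(** A regular point in the disc refutes the kernel alternative of [tame_or_kernel], and serves as
    the starting point for the other one. *)
Lemma good_local z0 d : U !=set0 -> 0 < d -> (forall x, U x -> d <= normc (x%:C - z0)) ->
  L2 (phi z0) -> exists2 r, 0 < r &
  (exists z, normc (z - z0) < r /\ good z) -> forall z, normc (z - z0) < r -> good z.
Proof.
move=> U0 d0 hd Lphi; have [r r0 hr] := tame_or_kernel mU H_rks d0 hd Lphi U0.
exists r => // -[z1 [z1r gz1]].
(* The starting point must differ from the centre, where division by (z - z0)^n fails; [e] keeps it
   in the disc and away from z0. *)
have [z2 [z2r z20 rz2]] : exists z2, [/\ normc (z2 - z0) < r, z2 != z0 & reg z2].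
  have [z10|z10] := eqVneq z1 z0.
    have [z2 [? ? ?]] := good_reg_near gz1 r0; exists z2.
    by rewrite -z10; split => //; rewrite z10 in z1r *; rewrite -z10.
  pose e := Num.min (r - normc (z1 - z0)) (normc (z1 - z0)).
  have e0 : 0 < e by rewrite lt_min subr_gt0 z1r normc_gt0 subr_eq0.
  have [z2 [_]] := good_reg_near gz1 e0; rewrite lt_min => /andP[h1 h2] rz2.
  exists z2; split => //.
    by have := normcD (z2 - z1) (z1 - z0); rewrite subrKA; lra.
  by apply/eqP => z20; move: h2; rewrite z20 normcB ltxx.
case: hr => [ker|hr]; first by have := reg_not_kernel rz2 (ker _ z2r).
have [|n nN tz0] := hr.
  by exists z2; split => //; have [M [_ ex _]] := rz2.
move=> z zr; have [->|zz0] := eqVneq z z0; first by exists n, r.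
by apply: reg_good; apply: (tame_reg tz0 zr); rewrite (negbTE zz0).
Qed.

(** c / (x - z) = f / (x - z) - h, and for nonreal z both terms on the right are in L2. A point z
    above k with c nonzero gives the kernel at z, and a bounded multiplier moves it to z0. *)
Lemma L2_phi z0 d : 0 < d -> (forall x, U x -> d <= normc (x%:C - z0)) ->
  (exists2 f, H f & exists2 k, U k & f k <> 0 /\ reg k%:C) -> L2 (phi z0).
Proof.
move=> d0 hd [f Hf [k Uk [fk0 [M B]]]]; have [M0 _ hM] := B.
have [C C0 hC] := H_eval H_rks Uk.
have nfk : 0 < normc (f k) by rewrite normc_gt0; apply/eqP.
have M10 : 0 < M + 1 by rewrite ltr_wpDl.
pose K := C * (2 * M * nrm f) + 1.
have K0 : 0 < K by rewrite ltr_wpDl// mulr_ge0// mulr_ge0 ?nrm_ge0// mulr_ge0.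
(* The second entry ensures c is nonzero: c = 0 would give |f k| = |z - k| |h k|, too small. *)
pose e := Num.min (2^-1 / (M + 1)) (normc (f k) / K).
have e0 : 0 < e by rewrite lt_min !divr_gt0// invr_gt0.
pose q := e / 2; have q0 : 0 < q by rewrite divr_gt0.
have qe : q < e by rewrite ltr_pdivrMr// ltr_pMr// ltr1n.
pose z : R[i] := k +i* q.
have zk : normc (z - k%:C) = q.
  by rewrite /z /= subrr subr0 expr0n/= add0r sqrtr_sqr gtr0_norm.
have [q1 q2] : q < 2^-1 / (M + 1) /\ q < normc (f k) / K.
  by move: qe; rewrite lt_min => /andP.
have [|M20 ex hM2] := bres_near mU H_rks B (z := z).
  rewrite zk; move: q1; rewrite ltr_pdivlMr// => /ltW; apply: le_trans.
  by rewrite ler_wpM2l ?lerDl// ltW.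
have [c [h r1]] := ex f Hf.
have [hB _] := hM2 _ _ _ Hf r1.
have := (res_shift U H (fun=> 1) k%:C z f c h).1 r1.
move=> [Hh /(_ k Uk)]; rewrite subrr mulr0 mulr1 => /esym/eqP.
rewrite subr_eq0 => /eqP cE.
have c0 : c != 0.
  apply/eqP => c0; move: cE; rewrite c0 => /eqP; rewrite addr_eq0 => /eqP fkE.
  have : normc (f k) <= q * (C * (2 * M * nrm f)).
    rewrite fkE normcN Normc.normcM zk ler_wpM2l ?(ltW q0)//.
    by apply: le_trans (hC _ Hh) _; rewrite ler_wpM2l.
  apply/negP; rewrite -ltNge; move: q2; rewrite ltr_pdivlMr//.
  by apply: le_lt_trans; rewrite ler_wpM2l ?lerDl// ltW.
have zq x : U x -> q <= normc (x%:C - z).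
  move=> _; rewrite -[q]gtr0_norm// -normrN.
  by have := Im_le_normc (x%:C - z); rewrite /= sub0r.
have [Lf _] := L2_resolvent mU q0 zq (H_L2 H_rks Hf).
have Lz : L2 (phi z).
  have := (L2_mul mU (normc_ge0 c^-1) (borel_cst mU c^-1) (fun x _ => lexx _)
    (nrmB mU Lf (H_L2 H_rks Hh)).1).1.
  rewrite (_ : (fun x => _) = phi z)//; apply/funext => x.
  have [Ux|Ux] := pselect (U x); last first.
    by rewrite phi_out// (H_off H_rks Hf Ux) (H_off H_rks Hh Ux) mulr0 subr0 mulr0.
  have xz : x%:C - z != 0 by rewrite -normc_gt0 (lt_le_trans q0)// zq.
  rewrite phi_in//; apply: (mulfI c0); apply: (mulIf xz).
  rewrite mulrA divff// mul1r mulrBl r1.2// mulr1 mulrAC mulVf// mul1r.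
  by rewrite -mulrA mulVf// mulr1 opprB addrC subrK.
(* This is (x - z) / (x - z0). *)
pose m x : R[i] := (z0 - z) * (x%:C - z0)^-1 + 1.
have Lm := L2_mul (B := normc (z0 - z) * d^-1 + 1) mU _ (m := m) _ _ Lz.
rewrite (_ : phi z0 = fun x => m x * phi z x).
  apply: (Lm _ _ _).1.
  - by rewrite addr_ge0// mulr_ge0 ?normc_ge0// invr_ge0 ltW.
  - apply: borel_lin => //; last exact: borel_cst.
    exact: borel_resolvent.
  move=> x Ux; apply: le_trans (normcD _ _) _.
  rewrite Normc.normcM Normc.normcV Normc.normc1 lerD2r ler_wpM2l ?normc_ge0//.
  by rewrite lef_pV2 ?posrE ?hd// (lt_le_trans d0 (hd _ Ux)).
apply/funext => x; have [Ux|Ux] := pselect (U x); last by rewrite !phi_out// mulr0.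
have xz : x%:C - z != 0 by rewrite -normc_gt0 (lt_le_trans q0)// zq.
have xz0 : x%:C - z0 != 0 by rewrite -normc_gt0 (lt_le_trans d0)// hd.
rewrite !phi_in// /m; move: xz xz0; move: (x%:C) => y yz yz0.
by field; rewrite yz yz0.
Qed.

(** The parameters in [0, 1] where [P] holds form a relatively open and closed set; the radii of [D]
    are scaled so that the path stays in the given discs. *)
Lemma segment_locally_constant (P : R[i] -> Prop) (a b : R[i]) :
  (forall t : R, 0 <= t <= 1 -> exists2 r, 0 < r &
    (exists z, normc (z - (a + t%:C * (b - a))) < r /\ P z) ->
    forall z, normc (z - (a + t%:C * (b - a))) < r -> P z) ->
  P a -> P b.
Proof.
move=> loc Pa; pose g (t : R) := a + t%:C * (b - a).
have exr t : exists r, 0 <= t <= 1 -> 0 < r /\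
    ((exists z, normc (z - g t) < r /\ P z) -> forall z, normc (z - g t) < r -> P z).
  have [t01|nt] := boolP (0 <= t <= 1); last by exists 0.
  by have [r r0 hr] := loc t t01; exists r => _; split.
have [r rP] := choice exr.
have N0 : 0 < normc (b - a) + 1 by rewrite ltr_wpDl ?normc_ge0.
pose D t : set R := ball t (r t / (normc (b - a) + 1)).
have gD t s : D t s -> normc (g s - g t) < r t.
  rewrite /D -ball_normE/= ltr_pdivlMr// => h.
  rewrite (_ : g s - g t = (s - t)%:C * (b - a)); last by rewrite /g rmorphB/=; ring.
  rewrite Normc.normcM normcR; apply: le_lt_trans h.
  by rewrite distrC ler_wpM2l// lerDl.
have DD t : 0 <= t <= 1 -> D t t.
  by move=> /rP[r0 _]; apply: ballxx; rewrite divr_gt0.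
have gg t : 0 <= t <= 1 -> normc (g t - g t) < r t.
  by move=> /rP[r0 _]; rewrite subrr Normc.normc0.
pose B : set R := [set t | 0 <= t <= 1 /\ P (g t)].
have : B = `[0, 1]%classic.
  apply: (@segment_connected R 0 1).
  - by exists 0; split; rewrite ?lexx ?ler01// /g mul0r addr0.
  - exists (\bigcup_(t in B) D t).
      by apply: bigcup_open => t _; exact: ball_open.
    apply/seteqP; split => s.
      by move=> [s01 Ps]; split; [rewrite /= in_itv|exists s => //; exact: DD].
    move=> [/= + [t [t01 Pt] /gD gst]]; rewrite in_itv/= => s01; split => //.
    have [r0 hr] := rP t t01; apply: hr gst.
    by exists (g t); split => //; exact: gg.
  exists (~` \bigcup_(t in [set t | 0 <= t <= 1 /\ ~ P (g t)]) D t).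
    by apply: open_closedC; apply: bigcup_open => t _; exact: ball_open.
  apply/seteqP; split => s.
    move=> [s01 Ps]; split; first by rewrite /= in_itv.
    move=> [t [t01 Pt] /gD gst]; apply: Pt.
    have [r0 hr] := rP t t01; apply: hr (gg t t01).
    by exists (g s).
  move=> [/= + nD]; rewrite in_itv/= => s01; split => //.
  by apply: contrapT => Ps; apply: nD; exists s => //; exact: DD.
move=> /seteqP[_ /(_ 1)]; rewrite /= in_itv/= ler01 lexx => /(_ isT)[_].
by rewrite /g mul1r addrC subrK.
Qed.

Lemma good_nonreal z k : (forall z d, 0 < d -> (forall x, U x -> d <= normc (x%:C - z)) ->
   L2 (phi z)) -> U k -> reg k%:C -> Im z != 0 -> good z.
Proof.
move=> Lphi Uk /reg_tame[r r0 tk] z0.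
have r20 : 0 < r / 2 by rewrite divr_gt0.
pose s := Num.sg (Im z); have s0 : s != 0 by rewrite sgr_eq0.
(* A regular point near k, in the same half-plane as z. *)
pose a : R[i] := k +i* (s * (r / 2)).
apply: (@segment_locally_constant good a z) => [t t01|]; last first.
  apply: reg_good; apply: (tame_reg tk) => //.
  rewrite /a /= subrr subr0 expr0n/= add0r sqrtr_sqr.
  by rewrite normrM normr_sg z0 mul1r gtr0_norm// ltr_pdivrMr// ltr_pMr// ltr1n.
set w := _ + _.
(* The imaginary part keeps its sign along the segment, so its modulus is a lower bound for the
   distance to [U]. *)
have wE : Im w = s * ((1 - t) * (r / 2) + t * `|Im z|).
  have e : Im z = s * `|Im z| by rewrite /s -numEsg.
  have -> : Im w = s * (r / 2) + t * (Im z - s * (r / 2)).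
    by rewrite /w /a; case: (z) => x y; rewrite /= mul0r addr0.
  by rewrite {1}e; ring.
have Iw : 0 < `|Im w|.
  rewrite wE normrM normr_sg z0 mul1r normr_gt0 gt_eqF//.
  have [t0 t1] := andP t01; have [->|t10] := eqVneq t 1.
    by rewrite subrr mul0r add0r mul1r normr_gt0.
  by rewrite ltr_wpDr ?mulr_ge0// mulr_gt0// subr_gt0 lt_neqAle t10.
have wd x : U x -> `|Im w| <= normc (x%:C - w).
  by move=> _; have := Im_le_normc (x%:C - w); rewrite raddfB/= sub0r normrN.
by apply: (good_local _ Iw wd (Lphi w _ Iw wd)); exists k.
Qed.

End Good.

(** * Poles *)

Section Poles.
Context {R : realType} (mu : {measure set R -> \bar R}) (U : set R).
Hypothesis mU : measurable U.
Context (H : set (R -> R[i])).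
Hypothesis H_rks : reproducing_kernel_subspace mu U H.
Implicit Types f g h psi : R -> R[i].
Implicit Types z c : R[i].
Local Notation res := (res U H).
Local Notation bres := (bres mu U H).
Local Notation tame := (tame mu U H).

(* If the numerator [G] vanishes at [z0], then [G w = (w - z0) G' w] where [G']
   is the numerator attached to the solution [h0] at [z0], by [res_taylor]. *)
Lemma pole_form z0 n r f : tame z0 n r -> 0 < r -> H f ->
  exists m (G : Cplane R -> Cplane R), [/\ (m <= n)%N,
    forall w, normc (w - z0) < r -> derivable G w 1,
    forall w, normc (w - z0) < r -> w != z0 ->
      exists h, res (fun=> 1) w f (G w / (w - z0) ^+ m) h,
    (0 < m)%N -> G z0 != 0 &
    n = 0%N -> exists h, res (fun=> 1) z0 f (G z0) h].
Proof.
move=> [psi [M [psi1 hz]]] r0 Hf.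
have solG g : H g -> exists G : Cplane R -> Cplane R,
    forall w, normc (w - z0) < r -> exists h, res psi w g (G w) h.
  move=> Hg; have ex w : exists c, normc (w - z0) < r -> exists h, res psi w g c h.
    have [wr|?] := pselect (normc (w - z0) < r); last by exists 0.
    by have [[_ + _] _] := hz w wr; move=> /(_ g Hg)[c ?]; exists c.
  by have [G GP] := choice ex; exists G.
have derG g (G : Cplane R -> Cplane R) : H g ->
    (forall w, normc (w - z0) < r -> exists h, res psi w g (G w) h) ->
    forall w, normc (w - z0) < r -> derivable G w 1.
  move=> Hg GP w wr; have [B _] := hz w wr; apply: (res_derivable mU H_rks B Hg).
  apply/nbhs_normcP; exists (r - normc (w - z0)); rewrite ?subr_gt0// => y yw.
  by apply: GP; have := normcD (y - w) (w - z0); rewrite subrKA; lra.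
have z0r : normc (z0 - z0) < r by rewrite subrr Normc.normc0.
(* [m] is the order still allowed and [g] the current datum: a constant c for [g] at w gives the
   constant c / (w - z0)^m for [f]. *)
have main m : forall g, H g -> (m <= n)%N ->
    (forall w, normc (w - z0) < r -> w != z0 -> forall c h, res psi w g c h ->
      exists h', res (fun=> 1) w f (c / (w - z0) ^+ m) h') ->
    (n = 0%N -> g = f) ->
    exists m' (G : Cplane R -> Cplane R), [/\ (m' <= n)%N,
    forall w, normc (w - z0) < r -> derivable G w 1,
    forall w, normc (w - z0) < r -> w != z0 ->
      exists h, res (fun=> 1) w f (G w / (w - z0) ^+ m') h,
    (0 < m')%N -> G z0 != 0 &
    n = 0%N -> exists h, res (fun=> 1) z0 f (G z0) h].
  elim: m => [|m ih] g Hg mn gf n0; have [G GP] := solG g Hg; have dG := derG g G Hg GP.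
    exists 0%N, G; split => // [w wr wz|n0'].
      by have [h hw] := GP w wr; exact: gf wr wz _ _ hw.
    by have [h] := GP _ z0r; rewrite n0// psi1//; exists h.
  have [Gz0|Gz0] := eqVneq (G z0) 0; last first.
    exists m.+1, G; split => // [w wr wz|n0']; last by rewrite n0' in mn.
    by have [h hw] := GP w wr; exact: gf wr wz _ _ hw.
  have [h0 rz0] := GP _ z0r.
  apply: (ih h0 rz0.1 (ltnW mn)) => [w wr wz c' h' r'|n0']; last by rewrite n0' in mn.
  have [B _] := hz w wr; have [h hw] := GP w wr.
  have e := res_taylor H_rks B hw rz0 r'; rewrite Gz0 add0r in e.
  have [h1 h1P] := gf w wr wz _ _ hw; exists h1.
  have wz0 : w - z0 != 0 by rewrite subr_eq0.
  rewrite (_ : c' / _ = G w / (w - z0) ^+ m.+1)// e exprS invfM.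
  by rewrite mulrA [_ * (w - z0)^-1]mulrAC divff// mul1r.
apply: (main n f) => // w wr wz c h hw.
have [_ [s Hs hs]] := hz w wr.
have t0 : (w - z0) ^+ n != 0 by rewrite expf_neq0// subr_eq0.
by eexists; exact: (res_one H_rks t0 Hs hs hw).
Qed.

End Poles.

(** * Gluing the local solutions into a meromorphic extension *)

Theorem theorem3p1 (R : realType) (mu : {sigma_finite_measure set R -> \bar R})
    (mu_no_atoms : forall x : R, mu [set x] = 0%E)
    (U : set R) (U_borel : measurable U) (U_nonempty : U !=set0)
    (mu_off_U : mu (~` U) = 0%E)
    (H : set (R -> R[i])) (H_rks : reproducing_kernel_subspace mu U H)
    (H_div : forall k, U k -> forall f, H f ->
      quotient_in U H (fun x => f x - f k) k%:C) :
  let N := cauchy_kernel_set U H in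
  [/\ N `<=` ~` embed_line (closure U),
      discrete_in (off_boundary U) N
    & forall f, H f -> exists (P : set (Cplane R)) (F : Cplane R -> Cplane R),
        [/\ meromorphic_on (off_boundary U) P F, P `<=` N &
          forall x, U x -> ~ boundary U x -> F x%:C = f x]].
Proof.
move=> N.
have N_off : N `<=` ~` embed_line (closure U).
  move=> z [zb [h Hh hE]] [x Ux xz].
  have [iU|niU] := pselect (interior U x); last by apply: zb; exists x.
  have := hE x (interior_subset iU); rewrite -xz subrr mulr0 => /esym/eqP.
  by rewrite oner_eq0.
(* If [H] = 0 the kernel set is empty, since [U] has a point where h (x - z) = 1 fails. *)
have [Hnz|Hz] := pselect (exists f k, [/\ H f, U k & f k <> 0]); last first.
  have Hz0 f x : H f -> f x = 0.
    move=> Hf; have [Ux|Ux] := pselect (U x); last exact: (H_off H_rks Hf).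
    by apply: contrapT => fx; apply: Hz; exists f, x.
  have N0 z : ~ N z.
    move=> [_ [h Hh hE]]; have [k Uk] := U_nonempty.
    by have := hE k Uk; rewrite Hz0// mul0r => /esym/eqP; rewrite oner_eq0.
  split => //.
    move=> z _ /(_ setT filterT)[y [_ Ny _]]; exact: N0 Ny.
  move=> f Hf; exists set0, (fun=> 0); split => //.
    split => //.
    by move=> z _ /(_ setT filterT)[y [_ ]].
  by move=> x _ _; rewrite Hz0.
have regU k : U k -> reg mu U H k%:C.
  by move=> Uk; exact: (bres_real U_borel H_rks (mu_no_atoms k) Uk (H_div k Uk)).
have Lphi z d : 0 < d -> (forall x, U x -> d <= normc (x%:C - z)) ->
    square_integrable mu U (phi U z).
  move=> d0 hd; apply: (L2_phi U_borel H_rks d0 hd).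
  have [f [k [Hf Uk fk]]] := Hnz; exists f => //; exists k => //; split => //.
  exact: regU.
have [k0 Uk0] := U_nonempty.
have goodall z : off_boundary U z -> good mu U H z.
  move=> zb; have [Iz|Iz] := eqVneq (Im z) 0; last first.
    exact: (good_nonreal U_borel H_rks Lphi Uk0 (regU _ Uk0) Iz).
  have zE : z = (Re z)%:C by case: z {zb} Iz => a b /= ->.
  have [Uz|Uz] := pselect (U (Re z)).
    by rewrite zE; apply: (reg_good U_borel H_rks); exact: regU.
  have nclos : ~ closure U (Re z).
    move=> cl; apply: zb; exists (Re z); last by rewrite -zE.
    by split => // iU; apply: Uz; exact: interior_subset iU.
  have [d d0 hd] : exists2 d : R, 0 < d & forall x, U x -> d <= normc (x%:C - z).
    have oC : open (~` closure U) by exact/closed_openC/closed_closure.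
    have /nbhs_ballP[d d0 hd] : nbhs (Re z) (~` closure U).
      by apply: open_nbhs_nbhs; split.
    exists d => // x Ux; rewrite zE -rmorphB normcR leNgt; apply/negP => xd.
    apply: (hd x); last exact: subset_closure.
    by rewrite -ball_normE/= distrC.
  have [r r0] := good_local U_borel H_rks U_nonempty d0 hd (Lphi _ _ d0 hd).
  have r20 : 0 < r / 2 by rewrite divr_gt0.
  apply; last by rewrite subrr Normc.normc0.
  (* A nonreal point of the disc, already known to be good. *)
  exists (z + 0 +i* (r / 2)); split.
    rewrite addrAC subrr add0r /= expr0n/= add0r sqrtr_sqr gtr0_norm//.
    by rewrite ltr_pdivrMr// ltr_pMr// ltr1n.
  apply: (good_nonreal U_borel H_rks Lphi Uk0 (regU _ Uk0)).
  by rewrite raddfD/= Iz add0r gt_eqF.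
have off_open z : off_boundary U z -> \forall w \near z, off_boundary U w.
  move=> zb; apply/nbhs_normcP; have [Iz|Iz] := eqVneq (Im z) 0; last first.
    exists `|Im z|; first by rewrite normr_gt0.
    move=> w wz [x _ xw]; move: wz; rewrite ltNge => /negP; apply.
    by have := Im_le_normc (w - z); rewrite -xw raddfB/= sub0r normrN.
  have zE : z = (Re z)%:C by case: z {zb} Iz => a b /= ->.
  have nb : ~ boundary U (Re z) by move=> bz; apply: zb; exists (Re z).
  have oB : open (~` boundary U).
    rewrite /boundary setDE setCI setCK; apply: openU; last exact: open_interior.
    exact/closed_openC/closed_closure.
  have /nbhs_ballP[d d0 hd] : nbhs (Re z) (~` boundary U).
    by apply: open_nbhs_nbhs; split.
  exists d => // w wz [x bx xw]; apply: (hd x) bx.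
  by move: wz; rewrite -xw zE -rmorphB normcR -ball_normE/= distrC.
have discN : discrete_in (off_boundary U) N.
  move=> z zb limz; have [n [r [r0 _ tz]]] := goodall z zb.
  have /limz[w [wz [_ Nw]]] : nbhs z [set w : Cplane R | normc (w - z) < r].
    by apply/nbhs_normcP; exists r.
  move=> wr; apply: (reg_not_kernel H_rks _ Nw).
  by apply: (tame_reg U_borel H_rks tz wr); rewrite (negbTE wz).
split => // f Hf.
(* Each point gets an order and a numerator; regular points exclude the kernel and so have order
   0. *)
have exG (z : Cplane R) : exists mG : nat * (Cplane R -> Cplane R), off_boundary U z ->
    ((0 < mG.1)%N -> N z /\ mG.2 z != 0) /\
    (exists2 r, 0 < r & (forall w, normc (w - z) < r -> derivable mG.2 w 1) /\
      forall w, normc (w - z) < r -> w != z -> reg mu U H w /\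
        exists h, res U H (fun=> 1) w f (mG.2 w / (w - z) ^+ mG.1) h) /\
    (reg mu U H z -> mG.1 = 0%N /\ exists h, res U H (fun=> 1) z f (mG.2 z) h).
  have [zb|?] := pselect (off_boundary U z); last by exists (0%N, fun=> 0).
  have [n [r [r0 nN tz]]] := goodall z zb.
  have [m [G [mn dG rG G0 Gn]]] := pole_form U_borel H_rks tz r0 Hf.
  exists (m, G) => _; split; [|split].
  - move=> m0; split; last exact: G0.
    by split => //; apply: nN; exact: leq_trans mn.
  - exists r => //; split => // w wr wz; split; last exact: rG.
    by apply: (tame_reg U_borel H_rks tz wr); rewrite (negbTE wz).
  move=> rz; have n0 : n = 0%N.
    by apply/eqP; rewrite -leqn0 leqNgt; apply/negP => /nN/(reg_not_kernel H_rks rz).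
  by split; [apply/eqP; rewrite -leqn0 -n0|exact: Gn].
have [mG mGP] := choice exG.
pose P : set (Cplane R) := [set z | off_boundary U z /\ (0 < (mG z).1)%N].
(* The value at z is read off the numerator centred at z; at points of [P] it is irrelevant. *)
pose F (z : Cplane R) : Cplane R := (mG z).2 z.
have PN : P `<=` N by move=> z [zb m0]; have [/(_ m0)[]] := mGP z zb.
(* Points w near z other than z are regular, so uniqueness of c there identifies the numerator
   centred at w with the formula centred at z. *)
have FE z : off_boundary U z -> \forall w \near z, w != z ->
    F w = (mG z).2 w / (w - z) ^+ (mG z).1.
  move=> zb; have [_ [[r r0 [_ hr]] _]] := mGP z zb.
  have : \forall w \near z, normc (w - z) < r by apply/nbhs_normcP; exists r.
  apply: filterS2 (off_open z zb) => w wb wr wz.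
  have [rw [h1 h1P]] := hr w wr wz; have [_ [_ /(_ rw)[_ [h2 h2P]]]] := mGP w wb.
  have [M B] := rw; exact: (res_uniq H_rks B h2P h1P).1.
exists P, F; split => //; first split.
- by move=> z [].
- move=> z zb limz; apply: (discN z zb) => V /limz[w [wz Pw Vw]].
  by exists w; split => //; exact: PN.
- move=> z zb nP; have m0 : (mG z).1 = 0%N.
    by apply/eqP; rewrite -leqn0 leqNgt; apply/negP => ?; apply: nP.
  have [_ [[r r0 [dG _]] _]] := mGP z zb.
  have dz : derivable (mG z).2 z 1 by apply: dG; rewrite subrr Normc.normc0.
  apply: (near_eq_derivable _ dz); apply: filterS (FE z zb) => w.
  rewrite m0 expr0 divr1; have [->//|wz] := eqVneq w z; by move=> /(_ isT).
- move=> p [pb m0]; exists (mG p).1, (mG p).2.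
  have [/(_ m0)[_ Gp] [[r r0 [dG _]] _]] := mGP p pb; split => //.
    by apply/nbhs_normcP; exists r.
  exact: FE.
move=> x Ux nbx.
have xb : off_boundary U (x%:C : Cplane R).
  by move=> [y by_ /complexI yx]; apply: nbx; rewrite -yx.
have [_ [_ /(_ (regU x Ux))[_ [h [Hh /(_ x Ux)]]]]] := mGP _ xb.
by rewrite subrr mulr0 mulr1 => /esym/eqP; rewrite subr_eq0 => /eqP ->.
Qed.
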